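(* Let $G$ be a second countable locally compact Abelian group and let $E\in\mathcal E$. Suppose the generalised translation-invariant system $\bigcup_{j\in J}\{T_\gamma g_{j,p}\}_{\gamma\in\Gamma_j,\,p\in P_j}$ in $L^2(G)$ satisfies the local integrability condition with respect to $E$. Then it satisfies the Calderón integrability condition with respect to $E$.
   Context: $G$ is a second countable locally compact Hausdorff Abelian group, written additively, with Haar measure $\mu_G$; $\widehat G$ is its Pontryagin dual, written multiplicatively, with the Plancherel Haar measure $\mu_{\widehat G}$ relative to $\mu_G$. $\hat f$ is the Fourier–Plancherel transform of $f\in L^2(G)$, and $T_\gamma f = f(\cdot-\gamma)$. For a closed subgroup $\Gamma\subseteq G$, $\Gamma^\perp=\{\omega\in\widehat G: \omega(x)=1\ \forall x\in\Gamma\}$. $\Gamma$ is co-compact if $G/\Gamma$ is compact. Each $\Gamma$ carries a given Haar measure $\mu_\Gamma$ (the counting measure if $\Gamma$ is a uniform lattice, i.e. discrete and co-compact), $G/\Gamma$ carries the Haar measure making Weil's formula $\int_G f\,d\mu_G=\int_{G/\Gamma}\int_\Gamma f(x+\gamma)\,d\mu_\Gamma(\gamma)\,d\mu_{G/\Gamma}(\dot x)$ hold, and the covolume is $\mathrm{d}(\Gamma)=\mu_{G/\Gamma}(G/\Gamma)$. Generalised translation-invariant (GTI) system: $J$ is countable; for each $j\in J$, $\Gamma_j\subseteq G$ is a closed, co-compact subgroup and $P_j$ is an index set with functions $g_{j,p}\in L^2(G)$, $p\in P_j$; the system is $\bigcup_{j\in J}\{T_\gamma g_{j,p}:\gamma\in\Gamma_j,p\in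 P_j\}$. Standing hypotheses for each $j$: (I) $(P_j,\Sigma_{P_j},\mu_{P_j})$ is a $\sigma$-finite measure space; (II) $p\mapsto g_{j,p}$ is measurable from $(P_j,\Sigma_{P_j})$ to $L^2(G)$ with its Borel $\sigma$-algebra; (III) $(p,x)\mapsto g_{j,p}(x)$ is $\Sigma_{P_j}\otimes\mathcal B_G$-measurable. $\mathcal E$ is the collection of closed sets $E\subseteq\widehat G$ of Haar measure zero. $\mathcal D_E(G)$ is the set of $f\in L^2(G)$ such that $\hat f\in L^\infty(\widehat G)$ has compact support $\operatorname{supp}\hat f\subseteq\widehat G\setminus E$. Local integrability condition (w.r.t. $E$): for all $f\in\mathcal D_E(G)$, $$\sum_{j\in J}\frac1{\mathrm{d}(\Gamma_j)}\int_{P_j}\sum_{\alpha\in\Gamma_j^\perp}\int_{\operatorname{supp}\hat f}|\hat f(\omega\alpha)\hat g_{j,p}(\omega)|^2\,d\mu_{\widehat G}(\omega)\,d\mu_{P_j}(p)<\infty.$$ Equivalently, for all compact $K\subseteq\widehat G\setminus E$, $\sum_{j\in J}\frac1{\mathrm{d}(\Gamma_j)}\int_{P_j}\sum_{\alpha\in\Gamma_j^\perp}\int_{K\cap\alpha^{-1}K}|\hat g_{j,p}(\omega)|^2\,d\mu_{\widehat G}(\omega)\,d\mu_{P_j}(p)<\infty$. Calderón integrability condition (w.r.t. $E$): $\sum_{j\in J}\frac1{\mathrm{d}(\Gamma_j)}\int_{P_j}|\hat g_{j,p}(\cdot)|^2\,d\mu_{P_j}(p)\in L^1_{\mathrm{loc}}(\widehat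 G\setminus E)$, i.e. it is integrable over every compact $K\subseteq\widehat G\setminus E$. *)

(* Defs.v *)
From HB Require Import structures.
From mathcomp Require Import all_boot all_order all_algebra.
From mathcomp Require Import complex.
From mathcomp Require Import all_classical all_reals all_analysis.

Set Implicit Arguments.
Unset Strict Implicit.
Unset Printing Implicit Defensive.

Import Order.TTheory GRing.Theory Num.Theory numFieldNormedType.Exports.
Local Open Scope classical_set_scope.
Local Open Scope ring_scope.

Definition borel (T : ptopologicalType) : Type := g_sigma_algebraType (@open T).
HB.instance Definition _ (T : ptopologicalType) := Measurable.on (borel T).

(* Measurable types must carry a distinguished point; its value is irrelevant. *)
Definition pointed_group (G : topologicalZmodType) : Type := G.
HB.instance Definition _ (G : topologicalZmodType) :=
  Topological.on (pointed_group G).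
HB.instance Definition _ (G : topologicalZmodType) :=
  isPointed.Build (pointed_group G) (0 : G).

Notation borelG G := (borel (pointed_group G)).

Section haar.
Context {R : realType} {T : ptopologicalType}.
Implicit Type mu : {measure set (borel T) -> \bar R}.

(* Finite on compact sets, outer regular on Borel sets, inner regular on open
   sets; a Borel measure that is finite on compact sets is automatically regular
   on a second countable locally compact Hausdorff space. *)
Definition radon_measure mu : Prop :=
  [/\ forall K : set T, compact K -> (mu K < +oo)%E,
      forall A : set (borel T), measurable A ->
        mu A = ereal_inf [set mu U | U in [set U : set T | open U /\ A `<=` U]]
    & forall U : set T, open U ->
        mu U = ereal_sup
          [set mu K | K in [set K : set T | compact K /\ K `<=` U]]].

(* Haar measure of the abelian topological group whose law is op. *)
Definition haar_measure (op : T -> T -> T) mu : Prop :=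
  [/\ radon_measure mu, mu setT != 0%E
    & forall (a : T) (A : set (borel T)), measurable A ->
        mu (op a @^-1` A) = mu A].

End haar.

Section complex_valued.
Context {R : realType} {d : measure_display} {T : measurableType d}.
Implicit Types (f : T -> R[i]) (mu : {measure set T -> \bar R}).

Definition cmeasurable f : Prop :=
  measurable_fun [set: T] (fun x => complex.Re (f x)) /\
  measurable_fun [set: T] (fun x => complex.Im (f x)).

Definition cintegral mu f : R[i] :=
  Complex (\int[mu]_x complex.Re (f x)) (\int[mu]_x complex.Im (f x)).

Definition cnorm mu (p : \bar R) f : \bar R :=
  Lnorm mu p (fun x => (Normc.normc (f x))%:E).

(* Representatives of the elements of the complex Lebesgue space L^p(mu). *)
Definition Lp mu (p : \bar R) : set (T -> R[i]) :=
  [set f | cmeasurable f /\ (cnorm mu p f < +oo)%E].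

Definition L2_open mu : set (set (T -> R[i])) :=
  [set U | U `<=` Lp mu 2%:E /\
    forall f, U f -> exists2 e : R, 0 < e &
      forall h, Lp mu 2%:E h -> (cnorm mu 2%:E (h \- f)%R < e%:E)%E -> U h].

(* Since all sets in L2_open are saturated for almost everywhere equality, this
   is measurability for the Borel sigma-algebra of the quotient space. *)
Definition L2_measurable mu {d' : measure_display} {P : measurableType d'}
    (g : P -> T -> R[i]) : Prop :=
  forall B : set (T -> R[i]),
    <<s Lp mu 2%:E, L2_open mu >> B -> measurable (g @^-1` B).

End complex_valued.

Section dual.
Context (R : realType) (G : topologicalZmodType).

Record dual : Type := Dual {
  dual_fun :> G -> R[i];
  dual_continuous : continuous (dual_fun : G -> (R[i] : numFieldType));
  dual_norm : forall x, Normc.normc (dual_fun x) = 1;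
  dual_add : forall x y, dual_fun (x + y) = dual_fun x * dual_fun y
}.

HB.instance Definition _ := gen_eqMixin dual.
HB.instance Definition _ := gen_choiceMixin dual.

Definition dual_compact_open (w : dual) :
  {compact-open, G -> (R[i] : numFieldType)} := w.

HB.instance Definition _ :=
  Topological.copy dual (initial_topology dual_compact_open).

Lemma dual_one_subproof1 : continuous ((fun=> 1) : G -> (R[i] : numFieldType)).
Proof. exact: cst_continuous. Qed.

Lemma dual_one_subproof2 (x : G) : Normc.normc (1 : R[i]) = 1.
Proof. exact: Normc.normc1. Qed.

Lemma dual_one_subproof3 (x y : G) : 1 = 1 * 1 :> R[i].
Proof. by rewrite mulr1. Qed.

Definition dual_one : dual :=
  Dual dual_one_subproof1 dual_one_subproof2 dual_one_subproof3.

HB.instance Definition _ := isPointed.Build dual dual_one.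

Lemma dual_mul_subproof1 (v w : dual) :
  continuous ((fun x => v x * w x) : G -> (R[i] : numFieldType)).
Proof. by move=> x; apply: continuousM; exact: dual_continuous. Qed.

Lemma dual_mul_subproof2 (v w : dual) (x : G) : Normc.normc (v x * w x) = 1.
Proof. by rewrite Normc.normcM !dual_norm mulr1. Qed.

Lemma dual_mul_subproof3 (v w : dual) (x y : G) :
  v (x + y) * w (x + y) = (v x * w x) * (v y * w y).
Proof. by rewrite !dual_add mulrACA. Qed.

Definition dual_mul (v w : dual) : dual :=
  Dual (@dual_mul_subproof1 v w) (@dual_mul_subproof2 v w)
       (@dual_mul_subproof3 v w).

Definition annihilator (A : set G) : set dual :=
  [set w | forall x, A x -> w x = 1].

End dual.
Arguments dual_one {R G}.
Arguments annihilator R {G} A.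

Section subgroups.
Local Open Scope quotient_scope.
Context (G : topologicalZmodType).

Record closed_subgroup : Type := ClosedSubgroup {
  sg_set :> set G;
  sg_closed : closed sg_set;
  sg_zero : sg_set 0;
  sg_sub : forall x y, sg_set x -> sg_set y -> sg_set (x - y)
}.

Implicit Type H : closed_subgroup.

Lemma sg_opp H x : sg_set H x -> sg_set H (- x).
Proof. by move=> Hx; rewrite -sub0r; apply: sg_sub Hx; exact: sg_zero. Qed.

Lemma sg_add H x y : sg_set H x -> sg_set H y -> sg_set H (x + y).
Proof. by move=> Hx Hy; rewrite -[y]opprK; apply: sg_sub => //; exact: sg_opp. Qed.

Definition sg_type H : Type := set_type (sg_set H).
HB.instance Definition _ H := Topological.on (sg_type H).
HB.instance Definition _ H :=
  isPointed.Build (sg_type H) (SigSub (mem_set (sg_zero H))).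

Definition sg_val H (x : sg_type H) : G := set_val x.

Lemma sg_op_subproof H (x y : sg_type H) : sg_val x + sg_val y \in sg_set H.
Proof. by apply: mem_set; apply: sg_add; apply: set_valP. Qed.

Definition sg_op H (x y : sg_type H) : sg_type H := SigSub (sg_op_subproof x y).

Definition sg_discrete H : Prop := forall x : sg_type H, open [set x].

Definition coset_eq H : rel G := fun x y => `[< sg_set H (x - y) >].

Lemma coset_eq_refl H : reflexive (coset_eq H).
Proof. by move=> x; apply/asboolP; rewrite subrr; exact: sg_zero. Qed.

Lemma coset_eq_sym H : symmetric (coset_eq H).
Proof.
by move=> x y; apply/asboolP/asboolP => h; rewrite -opprB; exact: sg_opp.
Qed.

Lemma coset_eq_trans H : transitive (coset_eq H).
Proof.
move=> y x z /asboolP h1 /asboolP h2; apply/asboolP.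
by rewrite -(subrK y x) -addrA; exact: sg_add.
Qed.

Canonical coset_equiv H :=
  EquivRel (coset_eq H) (@coset_eq_refl H) (@coset_eq_sym H) (@coset_eq_trans H).

Definition quotient H : Type := quotient_topology {eq_quot coset_equiv H}.
HB.instance Definition _ H := Topological.on (quotient H).

Definition coset H (x : G) : quotient H := \pi_{eq_quot coset_equiv H} x.
Definition coset_repr H (c : quotient H) : G :=
  repr (c : {eq_quot coset_equiv H}).

HB.instance Definition _ H := isPointed.Build (quotient H) (coset H 0).

Definition coset_add H (b c : quotient H) : quotient H :=
  coset H (coset_repr b + coset_repr c).

Definition cocompact H : Prop := compact [set: quotient H].

End subgroups.

(* The inner integral depends only on the coset, nu being invariant under H. *)
Definition weil_formula (R : realType) (G : topologicalZmodType)
    (H : closed_subgroup G) (mu : {measure set (borelG G) -> \bar R})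
    (nu : {measure set (borel (sg_type H)) -> \bar R})
    (rho : {measure set (borel (quotient H)) -> \bar R}) : Prop :=
  forall f : G -> R, mu.-integrable [set: borelG G] (EFin \o f) ->
    (\int[mu]_x (f x)%:E =
     \int[rho]_c \int[nu]_h (f (coset_repr c + sg_val h))%:E)%E.

Section plancherel.
Context {R : realType} {G : topologicalZmodType}.
Variables (muG : {measure set (borelG G) -> \bar R})
          (muD : {measure set (borel (dual R G)) -> \bar R}).

Definition fourier (f : G -> R[i]) (w : dual R G) : R[i] :=
  cintegral muG (fun x => f x * conjc (w x)).

Definition plancherel_measure : Prop :=
  haar_measure (@dual_mul R G) muD /\
  forall f : borelG G -> R[i], Lp muG 1%:E f -> Lp muG 2%:E f ->
    cnorm muD 2%:E (fourier f) = cnorm muG 2%:E f.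

(* h represents the image of the class of f under the extension by continuity of the Fourier
   transform from L^1 /\ L^2 to L^2. *)
Definition is_plancherel_transform
    (f : borelG G -> R[i]) (h : borel (dual R G) -> R[i]) : Prop :=
  Lp muD 2%:E h /\
  exists f_ : nat -> borelG G -> R[i],
    [/\ forall n, Lp muG 1%:E (f_ n) /\ Lp muG 2%:E (f_ n),
        cnorm muG 2%:E (f_ n \- f) @[n --> \oo] --> 0%E
      & cnorm muD 2%:E (fourier (f_ n) \- h)
          @[n --> \oo] --> 0%E].

Definition plancherel (f : borelG G -> R[i]) : dual R G -> R[i] :=
  xget (fun=> 0) [set h | is_plancherel_transform f h].

(* Support of a class of functions modulo almost everywhere equality. *)
Definition ess_support (h : dual R G -> R[i]) : set (dual R G) :=
  [set w | forall U, nbhs w U ->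
     ~ muD.-negligible (U `&` [set v | h v != 0] : set (borel (dual R G)))].

Definition null_closed : set (set (dual R G)) :=
  [set E | closed E /\ muD E = 0%E].

Definition test_space (E : set (dual R G)) : set (borelG G -> R[i]) :=
  [set f | [/\ Lp muG 2%:E f, Lp muD +oo%E (plancherel f),
              compact (ess_support (plancherel f))
            & ess_support (plancherel f) `<=` ~` E]].

End plancherel.

(* The part of a generalised translation-invariant system that belongs to one
   index j. *)
Record gti_layer (R : realType) (G : topologicalZmodType)
    (muG : {measure set (borelG G) -> \bar R}) : Type := GTILayer {
  gti_group : closed_subgroup G;
  gti_cocompact : cocompact gti_group;
  gti_haar : {measure set (borel (sg_type gti_group)) -> \bar R};
  gti_haarP : haar_measure (@sg_op G gti_group) gti_haar;
  (* a discrete co-compact subgroup is a uniform lattice *)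
  gti_haar_counting : sg_discrete gti_group ->
    forall A : set (borel (sg_type gti_group)), measurable A ->
      gti_haar A = counting A;
  gti_quot_haar : {measure set (borel (quotient gti_group)) -> \bar R};
  gti_quot_haarP : haar_measure (@coset_add G gti_group) gti_quot_haar;
  gti_weil : weil_formula muG gti_haar gti_quot_haar;
  gti_display : measure_display;
  gti_index : measurableType gti_display;
  gti_index_measure : {sigma_finite_measure set gti_index -> \bar R};
  gti_gen : gti_index -> borelG G -> R[i];
  gti_gen_L2 : forall p, Lp muG 2%:E (gti_gen p);
  gti_gen_measurable : L2_measurable muG gti_gen;
  gti_gen_joint_measurable :
    cmeasurable (fun z : gti_index * borelG G => gti_gen z.1 z.2)
}.

Section conditions.
Context {R : realType} {G : topologicalZmodType}.
Variables (muG : {measure set (borelG G) -> \bar R})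
          (muD : {measure set (borel (dual R G)) -> \bar R}).

Definition covolume (L : gti_layer muG) : \bar R :=
  gti_quot_haar L [set: quotient (gti_group L)].

Context {J : countType}.
Variable sys : J -> gti_layer muG.

Local Notation hat := (plancherel muG muD).

Definition local_integrability (E : set (dual R G)) : Prop :=
  forall f, test_space muG muD E f ->
    (\esum_(j in [set: J]) ((covolume (sys j))^-1 *
       \int[gti_index_measure (sys j)]_p
         \esum_(a in annihilator R (gti_group (sys j)))
           \int[muD]_(w in ess_support muD (hat f))
             (Normc.normc (hat f (dual_mul w a) * hat (gti_gen p) w) ^+ 2)%:E)
     < +oo)%E.

(* The integral over P_j for fixed w requires the transforms of the generators
   to be chosen jointly measurably. *)
Definition jointly_measurable_transforms
    (h : forall j, gti_index (sys j) -> borel (dual R G) -> R[i]) : Prop :=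
  forall j,
    (forall p, is_plancherel_transform muG muD (gti_gen p) (h j p)) /\
    cmeasurable (fun z : gti_index (sys j) * borel (dual R G) => h j z.1 z.2).

Definition calderon_sum
    (h : forall j, gti_index (sys j) -> borel (dual R G) -> R[i])
    (w : borel (dual R G)) : \bar R :=
  (\esum_(j in [set: J]) ((covolume (sys j))^-1 *
     \int[gti_index_measure (sys j)]_p (Normc.normc (h j p w) ^+ 2)%:E))%E.

(* By Tonelli's theorem two jointly measurable choices give the same sum almost
   everywhere; such a choice is required to exist. *)
Definition calderon_integrability (E : set (dual R G)) : Prop :=
  (exists h, jointly_measurable_transforms h) /\
  forall h, jointly_measurable_transforms h ->
    forall K : set (dual R G), compact K -> K `<=` ~` E ->
      muD.-integrable (K : set (borel (dual R G))) (calderon_sum h).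

End conditions.

(* Main.v *)
Require Import Defs.
From HB Require Import structures.
From mathcomp Require Import all_boot all_order all_algebra.
From mathcomp Require Import complex.
From mathcomp Require Import all_classical all_reals all_analysis.
From mathcomp Require Import measurable_realfun ess_sup_inf ring lra.

(* In the sum over the annihilator keep only the trivial character: if
   [|f^| >= c > 0] on a set [B], local integrability for [f] bounds the integral
   of the Calderon sum over [B] by Tonelli's theorem, and a compact set off [E]
   is covered by finitely many such [B]. Such [f] are constructed directly,
   without surjectivity of the Plancherel transform.

   Call a function on the dual approximable if it is an L2-limit of Fourier
   transforms of L1-L2 functions; it is then a Plancherel transform, by
   Riesz-Fischer in L2(G). Translations in [G] make the approximable functions
   stable under multiplication by evaluations [w |-> w x], hence by polynomials in
   them, hence by bounded pointwise limits of such polynomials. Iterating the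
   polynomial [3 s^2 - 2 s^3] gives sharp thresholds of [Re (w x / w0 x)], and a
   countable product of thresholds over a dense sequence of points of a compact
   subset of [G] is a compactly supported cutoff near [w0] in the compact-open
   topology. Multiplying by it the transform of [w0] restricted to a compact set of
   positive measure, which does not vanish near [w0], gives [f^].

   The dual is locally compact by Steinhaus' argument, as it carries a Haar
   measure. Jointly measurable transforms of the generators are obtained by
   truncating [g_p] to a set of finite measure chosen measurably in [p], so fast
   that the Fourier transforms converge almost everywhere. *)

Set Implicit Arguments.
Unset Strict Implicit.
Unset Printing Implicit Defensive.

Import Order.TTheory GRing.Theory Num.Theory numFieldNormedType.Exports.
Local Open Scope classical_set_scope.
Local Open Scope ring_scope.

(** * Complex-valued square integrable functions *)

Local Notation normc := Normc.normc.

Section complex_modulus.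
Context {R : realType}.
Implicit Types z w : R[i].

Lemma normc_ge0 z : 0 <= normc z.
Proof. by case: z => a b; exact: sqrtr_ge0. Qed.

Lemma normc_sqr z : normc z ^+ 2 = complex.Re z ^+ 2 + complex.Im z ^+ 2.
Proof. by case: z => a b; rewrite sqr_sqrtr// addr_ge0 ?sqr_ge0. Qed.

Lemma normcD_sqr z w :
  normc (z + w) ^+ 2 <= 2 * normc z ^+ 2 + 2 * normc w ^+ 2.
Proof.
rewrite !normc_sqr; case: z w => [a b] [c d] /=.
have := sqr_ge0 (a - c); have := sqr_ge0 (b - d); rewrite !expr2; nra.
Qed.

Lemma normc_opp z : normc (- z) = normc z.
Proof. by case: z => a b; rewrite /= !sqrrN. Qed.

Lemma normc_conjc z : normc (conjc z) = normc z.
Proof. by case: z => a b; rewrite /= sqrrN. Qed.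

Lemma normcB z w : normc (z - w) = normc (w - z).
Proof. by rewrite -normc_opp opprB. Qed.

Lemma norm_normc z : `|z| = (normc z)%:C%C.
Proof. by rewrite normc_def; case: z. Qed.

Lemma normc_triangle z w : normc (z + w) <= normc z + normc w.
Proof. by rewrite -lecR rmorphD/= -!norm_normc; exact: ler_normD. Qed.

Lemma ler_Re_normc z : `|complex.Re z| <= normc z.
Proof.
rewrite -(@ler_pXn2r _ 2)// ?nnegrE ?normc_ge0// normc_sqr real_normK ?num_real//.
by rewrite lerDl sqr_ge0.
Qed.

Lemma ler_Im_normc z : `|complex.Im z| <= normc z.
Proof.
rewrite -(@ler_pXn2r _ 2)// ?nnegrE ?normc_ge0// normc_sqr real_normK ?num_real//.
by rewrite lerDr sqr_ge0.
Qed.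

Lemma normc_le_ReIm z : normc z <= `|complex.Re z| + `|complex.Im z|.
Proof.
rewrite -(@ler_pXn2r _ 2)// ?nnegrE ?normc_ge0 ?addr_ge0//.
rewrite normc_sqr sqrrD !real_normK ?num_real//.
by rewrite lerD2r lerDl mulrn_wge0// mulr_ge0.
Qed.

End complex_modulus.

(** * Convergence to zero and square roots in the extended reals *)

Section ereal_cvg0.
Context {R : realType}.
Local Open Scope ereal_scope.

Lemma ge0_cvge0P (u : (\bar R)^nat) : (forall n, 0 <= u n) ->
  (u @ \oo --> 0) <-> (forall e : R, (0 < e)%R -> \forall n \near \oo, u n < e%:E).
Proof.
move=> u0; split.
  move=> /fine_cvgP[ufin /cvgrPdist_lt uc] e e0.
  have := uc _ e0; apply: filter_app; move: ufin; apply: filterS => n ufin /=.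
  rewrite sub0r normrN ger0_norm ?fine_ge0// => ue.
  by rewrite -(fineK ufin) lte_fin.
move=> h; apply/fine_cvgP; split.
  have := h _ (@ltr01 R); apply: filterS => n un.
  by rewrite ge0_fin_numE// (lt_trans un)// ltry.
apply/cvgrPdist_lt => e e0; have := h _ e0; apply: filterS => n un /=.
have ufin : u n \is a fin_num by rewrite ge0_fin_numE// (lt_trans un)// ltry.
by rewrite sub0r normrN ger0_norm ?fine_ge0// -lte_fin fineK.
Qed.

Lemma poweR_half_lt (x : \bar R) (e : R) : 0 <= x -> (0 < e)%R ->
  (x `^ (2^-1) < e%:E) = (x < (e ^+ 2)%:E).
Proof.
move=> x0 e0; have -> : (e ^+ 2)%:E = e%:E `^ 2.
  by rewrite poweR_EFin powR_mulrn// ltW.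
rewrite !ltNge; congr negb; apply/idP/idP => h.
  have -> : x = (x `^ 2^-1) `^ 2 by rewrite -poweRrM mulVf// poweRe1.
  by apply: gt0_ler_poweR => //; rewrite in_itv/= ?lee_fin ?(ltW e0) ?poweR_ge0 ?leey.
have -> : e%:E = (e%:E `^ 2) `^ 2^-1.
  by rewrite -poweRrM mulfV// poweRe1 ?lee_fin// ltW.
apply: gt0_ler_poweR => //; rewrite in_itv/= ?x0 ?leey ?andbT//.
by rewrite lee_fin powR_ge0.
Qed.

End ereal_cvg0.

(** The squared L2 norm. It avoids the square root in [cnorm] at the price of the factors 2 in the
    triangle inequality [nsqD]. *)
Definition nsq {R : realType} {d : measure_display} {T : measurableType d}
    (mu : {measure set T -> \bar R}) (f : T -> R[i]) : \bar R := (\int[mu]_x (normc (f x) ^+ 2)%:E)%E.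

Section L2.
Context {R : realType} {d : measure_display} {T : measurableType d}.
Implicit Types (f g h : T -> R[i]) (mu : {measure set T -> \bar R}).

Lemma nsq_ge0 mu f : (0 <= nsq mu f)%E.
Proof. by apply: integral_ge0 => x _; rewrite lee_fin sqr_ge0. Qed.

Lemma cnorm2E mu f : cnorm mu 2%:E f = (nsq mu f `^ 2^-1)%E.
Proof.
rewrite /cnorm unlock /nsq; congr (_ `^ _)%E; apply: eq_integral => x _.
by rewrite abse_EFin ger0_norm ?normc_ge0// poweR_EFin powR_mulrn ?normc_ge0.
Qed.

Lemma cnorm2_lt mu f (e : R) : 0 < e ->
  (cnorm mu 2%:E f < e%:E)%E = (nsq mu f < (e ^+ 2)%:E)%E.
Proof. by move=> e0; rewrite cnorm2E poweR_half_lt ?nsq_ge0. Qed.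

Lemma cnorm2_cvg0 mu (f : nat -> T -> R[i]) :
  (cnorm mu 2%:E (f n) @[n --> \oo] --> 0%E) <->
  (nsq mu (f n) @[n --> \oo] --> 0%E).
Proof.
have c0 n : (0 <= cnorm mu 2%:E (f n))%E by exact: Lnorm_ge0.
split=> /ge0_cvge0P => [/(_ c0)|/(_ (fun n => nsq_ge0 mu (f n)))] h;
  apply/ge0_cvge0P => [n|e e0]; rewrite ?nsq_ge0 ?c0//.
  have s0 : 0 < Num.sqrt e by rewrite sqrtr_gt0.
  have := h _ s0; apply: filterS => n.
  by rewrite cnorm2_lt// sqr_sqrtr// ltW.
have := h (e ^+ 2) _; rewrite exprn_gt0// => /(_ isT); apply: filterS => n.
by rewrite cnorm2_lt.
Qed.

Lemma Lp2P mu f : Lp mu 2%:E f <-> cmeasurable f /\ (nsq mu f < +oo)%E.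
Proof.
split=> -[mf fi]; split=> //.
  by move: fi; rewrite cnorm2E; apply: lty_poweRy; rewrite invr_neq0.
by rewrite cnorm2E poweR_lty.
Qed.

Lemma Lp1P mu f : Lp mu 1%:E f <->
  cmeasurable f /\ (\int[mu]_x (normc (f x))%:E < +oo)%E.
Proof.
rewrite /Lp/= /cnorm Lnorm1.
by under eq_integral do rewrite abse_EFin ger0_norm ?normc_ge0//.
Qed.

Lemma cmeasurableD f g : cmeasurable f -> cmeasurable g ->
  cmeasurable (fun x => f x + g x).
Proof.
move=> [f1 f2] [g1 g2]; split.
  rewrite (_ : (fun _ => _) = (fun x => complex.Re (f x)) \+ (fun x => complex.Re (g x))).
    exact: measurable_funD.
  by apply/funext => x/=; case: (f x) (g x) => [? ?] [? ?].
rewrite (_ : (fun _ => _) = (fun x => complex.Im (f x)) \+ (fun x => complex.Im (g x))).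
  exact: measurable_funD.
by apply/funext => x/=; case: (f x) (g x) => [? ?] [? ?].
Qed.

Lemma cmeasurableM f g : cmeasurable f -> cmeasurable g ->
  cmeasurable (fun x => f x * g x).
Proof.
move=> [f1 f2] [g1 g2]; split.
  rewrite (_ : (fun _ => _) = (fun x => complex.Re (f x) * complex.Re (g x) -
      complex.Im (f x) * complex.Im (g x))).
    by apply: measurable_funB; exact: measurable_funM.
  by apply/funext => x/=; case: (f x) (g x) => [? ?] [? ?].
rewrite (_ : (fun _ => _) = (fun x => complex.Re (f x) * complex.Im (g x) +
    complex.Im (f x) * complex.Re (g x))).
  by apply: measurable_funD; exact: measurable_funM.
by apply/funext => x/=; case: (f x) (g x) => [? ?] [? ?].
Qed.

Lemma cmeasurable_cst (z : R[i]) : cmeasurable (fun _ : T => z).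
Proof. by split; exact: measurable_cst. Qed.

Lemma cmeasurable_real (r : T -> R) : measurable_fun setT r ->
  cmeasurable (fun x => (r x)%:C%C).
Proof. by move=> mr; split => //=; exact: measurable_cst. Qed.

Lemma cmeasurableN f : cmeasurable f -> cmeasurable (fun x => - f x).
Proof.
move=> mf; rewrite (_ : (fun _ => _) = (fun x => (-1) * f x)).
  by apply: cmeasurableM => //; exact: cmeasurable_cst.
by apply/funext => x; rewrite mulN1r.
Qed.

Lemma cmeasurableB f g : cmeasurable f -> cmeasurable g ->
  cmeasurable (fun x => f x - g x).
Proof. by move=> mf mg; apply: cmeasurableD => //; exact: cmeasurableN. Qed.

Lemma cmeasurableJ f : cmeasurable f -> cmeasurable (fun x => conjc (f x)).
Proof.
move=> [f1 f2]; split.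
  by rewrite (_ : (fun _ => _) = (fun x => complex.Re (f x)))//;
    apply/funext => x; case: (f x).
rewrite (_ : (fun _ => _) = (fun x => - complex.Im (f x))).
  exact: measurableT_comp.
by apply/funext => x; case: (f x).
Qed.

Lemma cmeasurable_normc_sqr f : cmeasurable f ->
  measurable_fun setT (fun x => normc (f x) ^+ 2).
Proof.
move=> [f1 f2]; under eq_fun do rewrite normc_sqr.
by apply: measurable_funD; exact: measurable_funX.
Qed.

Lemma cmeasurable_normc f : cmeasurable f ->
  measurable_fun setT (fun x => normc (f x)).
Proof.
move=> mf; rewrite (_ : (fun _ => _) = Num.sqrt \o (fun x => normc (f x) ^+ 2)).
  apply: measurableT_comp; last exact: cmeasurable_normc_sqr.
  by apply: continuous_measurable_fun; exact: sqrt_continuous.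
by apply/funext => x /=; rewrite sqrtr_sqr ger0_norm ?normc_ge0.
Qed.

Lemma measurable_nsq f : cmeasurable f ->
  measurable_fun setT (fun x => (normc (f x) ^+ 2)%:E : \bar R).
Proof. by move=> mf; apply/measurable_EFinP; exact: cmeasurable_normc_sqr. Qed.

Lemma nsqD mu f g : cmeasurable f -> cmeasurable g ->
  (nsq mu (fun x => f x + g x)%R <= 2%:E * nsq mu f + 2%:E * nsq mu g)%E.
Proof.
move=> mf mg; rewrite /nsq -!ge0_integralZl//; last 4 first.
- exact: measurable_nsq.
- by move=> x _; rewrite lee_fin sqr_ge0.
- exact: measurable_nsq.
- by move=> x _; rewrite lee_fin sqr_ge0.
rewrite -ge0_integralD//; last 4 first.
- by move=> x _; rewrite -EFinM lee_fin mulr_ge0// sqr_ge0.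
- by apply: emeasurable_funM => //; exact: measurable_nsq.
- by move=> x _; rewrite -EFinM lee_fin mulr_ge0// sqr_ge0.
- by apply: emeasurable_funM => //; exact: measurable_nsq.
apply: ge0_le_integral => //.
- by move=> x _; rewrite lee_fin sqr_ge0.
- by apply: measurable_nsq; exact: cmeasurableD.
- by apply: emeasurable_funD => //; apply: emeasurable_funM => //; exact: measurable_nsq.
- by move=> x _; rewrite -!EFinM -EFinD lee_fin normcD_sqr.
Qed.

Lemma nsqB mu f g : nsq mu (fun x => f x - g x) = nsq mu (fun x => g x - f x).
Proof. by apply: eq_integral => x _; rewrite normcB. Qed.

Lemma nsq_tri mu f g h : cmeasurable f -> cmeasurable g -> cmeasurable h ->
  (nsq mu (fun x => f x - h x)%R <=
   2%:E * nsq mu (fun x => f x - g x)%R + 2%:E * nsq mu (fun x => g x - h x)%R)%E.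
Proof.
move=> mf mg mh; rewrite (_ : (fun x => f x - h x) =
  (fun x => (f x - g x) + (g x - h x))); first by apply: nsqD; exact: cmeasurableB.
by apply/funext => x; rewrite addrA subrK.
Qed.

End L2.

Lemma cnorm2_eq (R : realType) (d d' : measure_display)
    (T : measurableType d) (T' : measurableType d')
    (mu : {measure set T -> \bar R}) (mu' : {measure set T' -> \bar R})
    (f : T -> R[i]) (f' : T' -> R[i]) :
  cnorm mu 2%:E f = cnorm mu' 2%:E f' -> nsq mu f = nsq mu' f'.
Proof.
rewrite !cnorm2E => h; have := congr1 (fun x => x `^ 2)%E h.
by rewrite -!poweRrM mulVf// !poweRe1 ?nsq_ge0.
Qed.

(** * Pointwise limits of sequences of complex functions *)

Section pointwise_limit.
Context {R : realType}.

(** The telescoping series of the increments is dominated by a geometric series. *)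
Lemma geometric_increments_cvg (u : R^nat) (C : R) :
  (forall n, `|u n.+1 - u n| <= C * 2^-1 ^+ n) -> cvgn u.
Proof.
move=> uC.
have C0 : 0 <= C by have := uC 0%N; rewrite expr0 mulr1; apply: le_trans.
have : cvgn (series (telescope u)).
  apply: normed_cvg; apply: (@series_le_cvg _ _ (geometric C 2^-1)) => [n|n|n|].
  - exact: normr_ge0.
  - by rewrite /= mulr_ge0// exprn_ge0.
  - exact: uC.
  - by apply: is_cvg_geometric_series; rewrite ger0_norm// invf_lt1// ltr1n.
rewrite telescopeK => uc.
rewrite (_ : u = (fun n => (u n - u 0%N) + u 0%N)); first exact: is_cvgD uc (is_cvg_cst _).
by apply/funext => n; rewrite subrK.
Qed.

(* The limit superiors make this measurable without any convergence assumption;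
   it is the limit wherever the sequence converges. *)
Definition flim {T : Type} (f : nat -> T -> R[i]) (x : T) : R[i] :=
  Complex (fine (limn_esup (fun n => (complex.Re (f n x))%:E)))
          (fine (limn_esup (fun n => (complex.Im (f n x))%:E))).

Lemma flim_cvg {T : Type} (f : nat -> T -> R[i]) (x : T) :
  cvgn (fun n => complex.Re (f n x)) -> cvgn (fun n => complex.Im (f n x)) ->
  normc (f n x - flim f x) @[n --> \oo] --> (0 : R).
Proof.
have key (u : R^nat) : cvgn u -> u @ \oo --> fine (limn_esup (fun n => (u n)%:E)).
  move=> /cvg_ex[l ul]; have ule : (u n)%:E @[n --> \oo] --> l%:E.
    by apply: cvg_comp ul _; exact: cvg_id.
  by have [_ ->] := cvg_limn_einf_sup ule.
move=> /key cr /key ci.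
have h : `|complex.Re (f n x) - complex.Re (flim f x)| +
    `|complex.Im (f n x) - complex.Im (flim f x)| @[n --> \oo] --> (0 : R).
  rewrite -[X in _ --> X]addr0; apply: cvgD.
    rewrite -(normr0 R) -(subrr (complex.Re (flim f x))).
    by apply: cvg_norm; apply: cvgB; [exact: cr|exact: cvg_cst].
  rewrite -(normr0 R) -(subrr (complex.Im (flim f x))).
  by apply: cvg_norm; apply: cvgB; [exact: ci|exact: cvg_cst].
apply: squeeze_cvgr (cvg_cst 0) h; apply: nearW => n.
rewrite normc_ge0 (le_trans (normc_le_ReIm _))//.
by case: (f n x) (flim f x) => [a b] [c d].
Qed.

Lemma cmeasurable_flim {d : measure_display} {T : measurableType d}
    (f : nat -> T -> R[i]) : (forall n, cmeasurable (f n)) ->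
  cmeasurable (flim f).
Proof.
move=> mf; split => /=.
  apply: (@measurableT_comp _ _ _ _ _ _ fine); first exact: fine_measurable.
  by apply: measurable_fun_limn_esup => n; apply/measurable_EFinP; exact: (mf n).1.
apply: (@measurableT_comp _ _ _ _ _ _ fine); first exact: fine_measurable.
by apply: measurable_fun_limn_esup => n; apply/measurable_EFinP; exact: (mf n).2.
Qed.

End pointwise_limit.

(** * The Riesz-Fischer theorem for sequences with geometric Cauchy rate *)

Section riesz_fischer.
Context {R : realType} {d : measure_display} {T : measurableType d}.
Variables (mu : {measure set T -> \bar R}) (f : nat -> T -> R[i]).
Hypothesis mf : forall n, cmeasurable (f n).
Hypothesis f_cauchy : forall m n, (m <= n)%N ->
  (nsq mu (fun x => f n x - f m x)%R <= ((8^-1 ^+ m)%R)%:E)%E.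

(** The weight [4 ^+ k] lies strictly between two demands. Against the bound [8^-1 ^+ k] on the
    integrals it leaves the summable [2^-1 ^+ k], and finiteness of [S x] still forces increments of
    order [2^-1 ^+ k] at [x]. *)
Let S x : \bar R := (\sum_(k <oo) (4 ^+ k * normc (f k.+1 x - f k x) ^+ 2)%:E)%E.

Let term_ge0 k x : (0 <= (4 ^+ k * normc (f k.+1 x - f k x) ^+ 2)%:E)%E.
Proof. by rewrite lee_fin; apply: mulr_ge0; [exact: exprn_ge0|exact: sqr_ge0]. Qed.

Let mterm k : measurable_fun setT
  (fun x => (4 ^+ k * normc (f k.+1 x - f k x) ^+ 2)%:E : \bar R).
Proof.
apply/measurable_EFinP; apply: measurable_funM => //.
by apply: cmeasurable_normc_sqr; exact: cmeasurableB.
Qed.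

Let S_int : (\int[mu]_x S x < +oo)%E.
Proof.
rewrite integral_nneseries//.
have le k : (\int[mu]_x (4 ^+ k * normc (f k.+1 x - f k x) ^+ 2)%:E <= (2^-1 ^+ k)%:E)%E.
  under eq_integral do rewrite EFinM.
  rewrite ge0_integralZl//; last 2 first.
  - by apply: measurable_nsq; exact: cmeasurableB.
  - by move=> x _; rewrite lee_fin sqr_ge0.
  apply: (@le_trans _ _ ((4 ^+ k)%:E * (8^-1 ^+ k)%:E)%E).
    by apply: lee_wpmul2l; [rewrite lee_fin exprn_ge0|exact: f_cauchy].
  by rewrite -EFinM lee_fin -exprMn (_ : 4 * 8^-1 = 2^-1)//; lra.
apply: (@le_lt_trans _ _ (\sum_(k <oo) ((2^-1 ^+ k)%:E))%E).
  by apply: lee_nneseries => [k _ _|k _]; [exact: integral_ge0|exact: le].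
have -> : (\sum_(k <oo) ((2^-1 ^+ k)%R%:E : \bar R))%E =
          (\sum_(0 <= k <oo) ((2 / (2 ^ (k + 1))%:R)%R%:E))%E.
  apply: eq_eseriesr => k _; congr EFin.
  by rewrite addn1 expnS natrM invfM mulrA divff// mul1r natrX exprVn.
by rewrite (cvg_lim _ (@cvg_geometric_eseries_half _ 2 0))// expr0 divr1 ltry.
Qed.

(** [S] has finite integral, hence is finite almost everywhere, and at such points the increments
    are dominated by a geometric sequence. *)
Lemma cauchy_cvg_flim_ae :
  {ae mu, forall x, normc (f n x - flim f x) @[n --> \oo] --> (0 : R)}.
Proof.
have mS : measurable_fun setT S.
  by apply: ge0_emeasurable_sum => // k x _ _; exact: term_ge0.
have iS : mu.-integrable setT S.
  apply/integrableP; split=> //.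
  under eq_integral do rewrite gee0_abs ?nneseries_ge0//.
  exact: S_int.
have := integrable_ae measurableT iS; apply: filterS => x /(_ I) Sx.
(* A single term of the series is at most [S x]; taking roots turns [4 ^+ k] into [2 ^+ k]. *)
have dM k : normc (f k.+1 x - f k x) <= Num.sqrt (fine (S x)) * 2^-1 ^+ k.
  have : ((4 ^+ k * normc (f k.+1 x - f k x) ^+ 2)%:E <= S x)%E.
    apply: le_trans (@nneseries_lim_ge _ _ xpredT 0%N k.+1 _) => //.
    rewrite big_nat_recr//= leeDr// sume_ge0// => i _; exact: term_ge0.
  move=> h; rewrite -(fineK Sx) lee_fin in h.
  have S0 : 0 <= fine (S x) by apply: fine_ge0; exact: nneseries_ge0.
  rewrite -(@ler_pXn2r _ 2) ?nnegrE ?normc_ge0 ?mulr_ge0 ?sqrtr_ge0 ?exprn_ge0//.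
  rewrite exprMn sqr_sqrtr// -exprM mulnC exprM.
  have -> : (2^-1 ^+ 2) = 4^-1 :> R by rewrite exprVn -natrX.
  by rewrite exprVn ler_pdivlMr ?exprn_gt0// mulrC.
apply: flim_cvg; apply: (geometric_increments_cvg (C := Num.sqrt (fine (S x)))) => k.
  apply: le_trans (dM k); apply: le_trans (ler_Re_normc _).
  by case: (f k.+1 x) (f k x) => [? ?] [? ?].
apply: le_trans (dM k); apply: le_trans (ler_Im_normc _).
by case: (f k.+1 x) (f k x) => [? ?] [? ?].
Qed.

(** Fatou's lemma: almost everywhere [|flim f - f m|^2] is the limit in n of [|f n - f m|^2], whose
    integrals are at most [8^-1 ^+ m] once n reaches m. *)
Lemma riesz_fischer m :
  (nsq mu (fun x => flim f x - f m x)%R <= ((8^-1 ^+ m)%R)%:E)%E.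
Proof.
pose g n x : \bar R := (normc (f n x - f m x) ^+ 2)%:E.
have mg n : measurable_fun setT (g n).
  by apply: measurable_nsq; exact: cmeasurableB.
have g0 n x : (0 <= g n x)%E by rewrite lee_fin sqr_ge0.
have mlim : measurable_fun setT (fun x => limn_einf (g ^~ x)).
  (* The limit inferior is minus the limit superior of the negatives, so measurability of limit
     superiors suffices. *)
  under eq_fun do rewrite -[limn_einf _]oppeK -limn_esupN.
  apply: measurableT_comp => //; apply: measurable_fun_limn_esup => n.
  exact: measurableT_comp.
have lim0 x : (0 <= limn_einf (g ^~ x))%E.
  rewrite limn_einf_lim; apply: lime_ge; first exact: is_cvg_einfs.
  by apply: nearW => n; apply: le_ereal_inf_tmp => _ [k /= _ <-]; exact: g0.
apply: (@le_trans _ _ (\int[mu]_x limn_einf (g ^~ x))%E).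
  apply: ae_ge0_le_integral => //.
  - by move=> x _; rewrite lee_fin sqr_ge0.
  - by apply: measurable_nsq; apply: cmeasurableB => //; exact: cmeasurable_flim.
  have := cauchy_cvg_flim_ae; apply: filterS => x fx _.
  suff gx : g n x @[n --> \oo] --> (normc (flim f x - f m x) ^+ 2)%:E.
    by have [-> _] := cvg_limn_einf_sup gx.
  suff nx : normc (f n x - f m x) @[n --> \oo] --> normc (flim f x - f m x).
    apply: cvg_EFin; first exact: nearW.
    by rewrite expr2; under eq_fun do rewrite /g/= expr2; exact: cvgM.
  apply/cvgrPdist_le => e e0; move/cvgrPdist_le : fx => /(_ _ e0).
  apply: filterS => n; rewrite sub0r normrN ger0_norm ?normc_ge0// => h.
  have h1 : normc (flim f x - f m x) <= normc (f n x - flim f x) + normc (f n x - f m x).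
    rewrite [X in _ <= X + _]normcB.
    by apply: le_trans (normc_triangle _ _); rewrite addrA subrK.
  have h2 : normc (f n x - f m x) <= normc (f n x - flim f x) + normc (flim f x - f m x).
    by apply: le_trans (normc_triangle _ _); rewrite addrA subrK.
  by rewrite ler_norml; apply/andP; split; lra.
apply: (le_trans (fatou mu measurableT mg (fun n x _ => g0 n x))).
rewrite limn_einf_lim; apply: lime_le; first exact: is_cvg_einfs.
(* The infimum over the tail from n is bounded by its member of index [maxn m n], which also lies
   beyond m, where the Cauchy hypothesis applies. *)
apply: nearW => n; apply: (@le_trans _ _ (\int[mu]_x g (maxn m n) x)%E).
  by apply: ereal_inf_lbound; exists (maxn m n) => //=; exact: leq_maxr.
by apply: f_cauchy; exact: leq_maxl.
Qed.

End riesz_fischer.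

(** * The dual group *)

Section dual_topology.
Context {R : realType} {G : topologicalZmodType}.
Local Notation dual := (dual R G).
Implicit Types (v w : dual) (x y : G).

Lemma dual_ext v w : (forall x, v x = w x) -> v = w.
Proof.
case: v w => [v cv nv av] [w cw nw aw] /= vw.
have e : v = w by apply/funext.
by subst w; congr Dual; exact: Prop_irrelevance.
Qed.

Lemma dual_neq0 w x : w x != 0.
Proof.
apply/eqP => wx; have := dual_norm w x.
by rewrite wx Normc.normc0 => /esym/eqP; rewrite oner_eq0.
Qed.

Lemma dual0 w : w 0 = 1.
Proof.
have := dual_add w 0 0; rewrite addr0 => /esym h.
by apply: (mulfI (dual_neq0 w 0)); rewrite mulr1.
Qed.

Lemma dualVr w x : w x * w (- x) = 1.
Proof. by rewrite -dual_add subrr dual0. Qed.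

Lemma mulr_conjc_norm1 (z : R[i]) : normc z = 1 -> z * conjc z = 1.
Proof.
move=> z1; have : normc z ^+ 2 = 1 by rewrite z1 expr1n.
rewrite normc_sqr; case: z {z1} => a b /= h.
by apply/eqP; rewrite eq_complex /=; apply/andP; split; apply/eqP; rewrite /= -?h; ring.
Qed.

Lemma dualN w x : w (- x) = conjc (w x).
Proof.
apply: (mulfI (dual_neq0 w x)); rewrite dualVr mulr_conjc_norm1//.
exact: dual_norm.
Qed.

(** On continuous functions the compact-open topology is that of uniform convergence on compact
    sets; this makes the basic neighbourhoods explicit for all later estimates. *)
Lemma nbhs_dualP w0 (U : set dual) :
  nbhs w0 U <-> exists C : set G, exists2 e : R, compact C /\ 0 < e &
    [set w : dual | forall x, C x -> normc (w x - w0 x) < e] `<=` U.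
Proof.
pose f0 : G -> (R[i] : numFieldType) := w0.
have cf0 : continuous f0 by exact: dual_continuous.
split; last first.
  move=> [C [e [cC e0] CU]]; apply: filterS CU _.
  have FF : Filter (nbhs (dual_compact_open w0)) by exact: nbhs_filter.
  have /(compact_open_fam_compactP cf0 FF) h : {compact-open, nbhs (dual_compact_open w0) --> f0}.
    exact: cvg_id.
  have : nbhs (dual_compact_open w0)
     [set g : G -> (R[i] : numFieldType) | forall y, C y -> `|f0 y - g y| < e%:C%C].
    apply: h; have := @fam_nbhs G (R[i] : numFieldType) compact C
      [set p | `|p.1 - p.2| < e%:C%C] f0 _ cC; apply.
    by rewrite -entourage_ballE; exists e%:C%C => //=; rewrite ltcR.
  move=> hh; have hn : nbhs w0 (@dual_compact_open R G @^-1` [set g | forall y, C y -> `|f0 y - g y| < e%:C%C]).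
    exact: (@initial_continuous dual _ (@dual_compact_open R G) w0 _ hh).
  by apply: filterS hn => w /= hw x /hw; rewrite norm_normc ltcR normcB.
move=> [_ [[B oB <-] Bw0 BU]].
pose D (C : set G) (e : R) := [set g : G -> (R[i] : numFieldType) | forall x, C x -> normc (g x - w0 x) < e].
(* The candidate neighbourhoods generate the filter [F]. Once [F] is shown to converge to [w0] in
   the compact-open topology, every open set around [w0] belongs to it, hence contains some
   [D C e]. *)
pose F : set_system (G -> (R[i] : numFieldType)) := [set P | exists C : set G, exists2 e : R, compact C /\ 0 < e & D C e `<=` P].
have FF : Filter F.
  split.
  - exists set0; exists 1 => //; split => //; exact: compact0.
  - move=> P Q [C [e [cC e0] CP]] [C' [e' [cC' e'0] CQ]].
    exists (C `|` C'); exists (Num.min e e').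
      by split; [exact: compactU|rewrite lt_min e0].
    move=> g Dg; split; [apply: CP|apply: CQ] => x Cx.
      have : (C `|` C') x by left.
      by move=> /Dg; rewrite lt_min => /andP[].
    have : (C `|` C') x by right.
    by move=> /Dg; rewrite lt_min => /andP[].
  - move=> P Q PQ [C [e Ce CP]]; exists C; exists e => //; exact: subset_trans PQ.
have Ff0 : {compact-open, F --> f0}.
  apply/(compact_open_fam_compactP cf0 FF)/fam_cvgP => C cC.
  move=> P /uniform_nbhs [A [+ AP]]; rewrite -entourage_ballE => -[e /= e0 eA].
  (* In the order on complex numbers [0 < e] forces [e] to be real. *)
  have e1 : 0 < complex.Re e /\ e = (complex.Re e)%:C%C.
    by move: e0; case: (e) => a b; rewrite ltcE /= => /andP[/eqP -> ->].
  exists C; exists (complex.Re e); first by split=> //; exact: e1.1.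
  move=> g Dg; apply: AP => y /Dg h; apply: eA => /=.
  change (is_true (`|f0 y - g y| < e)).
  by rewrite e1.2 norm_normc ltcR normcB.
have : nbhs (f0 : {compact-open, G -> (R[i] : numFieldType)}) B.
  by apply: open_nbhs_nbhs; split.
move=> /Ff0 [C [e Ce CB]]; exists C; exists e => // w hw; apply: BU.
exact: CB.
Qed.

Lemma nbhs_dual w0 (C : set G) (e : R) : compact C -> 0 < e ->
  nbhs w0 [set w : dual | forall x, C x -> normc (w x - w0 x) < e].
Proof. by move=> cC e0; apply/nbhs_dualP; exists C; exists e. Qed.

Lemma dual_eval_near w0 x (e : R) : 0 < e ->
  nbhs w0 [set w : dual | normc (w x - w0 x) < e].
Proof.
move=> e0; have := @nbhs_dual w0 [set x] e (@compact_set1 _ x) e0.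
by apply: filterS => w; apply.
Qed.

Lemma dual_Re_continuous x : continuous (fun w : dual => complex.Re (w x)).
Proof.
move=> w0; have FF : Filter (nbhs w0) by exact: nbhs_filter.
apply/cvgrPdist_lt => e e0; have := dual_eval_near w0 x e0.
apply: filterS => w h; apply: le_lt_trans h; apply: le_trans (ler_Re_normc _).
by rewrite distrC; case: (w x) (w0 x) => [? ?] [? ?].
Qed.

Lemma dual_Im_continuous x : continuous (fun w : dual => complex.Im (w x)).
Proof.
move=> w0; have FF : Filter (nbhs w0) by exact: nbhs_filter.
apply/cvgrPdist_lt => e e0; have := dual_eval_near w0 x e0.
apply: filterS => w h; apply: le_lt_trans h; apply: le_trans (ler_Im_normc _).
by rewrite distrC; case: (w x) (w0 x) => [? ?] [? ?].
Qed.

Lemma dual_near w x0 (e : R) : 0 < e ->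
  nbhs x0 [set x : G | normc (w x - w x0) < e].
Proof.
move=> e0; have /cvgrPdist_lt/(_ e%:C%C) := @dual_continuous _ _ w x0.
rewrite ltcR => /(_ e0); apply: filterS => x.
by rewrite norm_normc ltcR normcB.
Qed.

Lemma dual_Re_continuous2 w : continuous (fun x : G => complex.Re (w x)).
Proof.
move=> x0; apply/cvgrPdist_lt => e e0; have := dual_near w x0 e0.
apply: filterS => x h; apply: le_lt_trans h; apply: le_trans (ler_Re_normc _).
by rewrite distrC; case: (w x) (w x0) => [? ?] [? ?].
Qed.

Lemma dual_Im_continuous2 w : continuous (fun x : G => complex.Im (w x)).
Proof.
move=> x0; apply/cvgrPdist_lt => e e0; have := dual_near w x0 e0.
apply: filterS => x h; apply: le_lt_trans h; apply: le_trans (ler_Im_normc _).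
by rewrite distrC; case: (w x) (w x0) => [? ?] [? ?].
Qed.

(** Distinct characters differ at some [x], and there the evaluation neighbourhoods of half the
    distance are disjoint. *)
Lemma dual_hausdorff : hausdorff_space dual.
Proof.
move=> v w clvw; apply: dual_ext => x.
apply/eqP; rewrite -subr_eq0; apply/negPn/negP => nz.
have e0 : 0 < normc (v x - w x) / 2.
  rewrite divr_gt0// lt_neqAle normc_ge0 andbT eq_sym.
  by apply: contra nz => /eqP/Normc.eq0_normc ->.
have [u [/= uv uw]] := clvw _ _ (dual_eval_near v x e0) (dual_eval_near w x e0).
have : normc (v x - w x) <= normc (u x - v x) + normc (u x - w x).
  rewrite [X in _ <= X + _]normcB.
  by apply: le_trans (normc_triangle _ _); rewrite addrA subrK.
lra.
Qed.

Lemma dual_inv_subproof1 w : continuous ((fun x => w (- x)) : G -> (R[i] : numFieldType)).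
Proof.
move=> x; apply: (@continuous_comp G G (R[i] : numFieldType) -%R w).
  exact: opp_continuous.
exact: dual_continuous.
Qed.

Lemma dual_inv_subproof2 w x : normc (w (- x)) = 1.
Proof. exact: dual_norm. Qed.

Lemma dual_inv_subproof3 w x y : w (- (x + y)) = w (- x) * w (- y).
Proof. by rewrite opprD dual_add. Qed.

Definition dual_inv w : dual :=
  Dual (@dual_inv_subproof1 w) (@dual_inv_subproof2 w) (@dual_inv_subproof3 w).

Lemma dual_mulC v w : dual_mul v w = dual_mul w v.
Proof. by apply: dual_ext => x /=; rewrite mulrC. Qed.

Lemma dual_mulA u v w : dual_mul u (dual_mul v w) = dual_mul (dual_mul u v) w.
Proof. by apply: dual_ext => x /=; rewrite mulrA. Qed.

Lemma dual_mul1 w : dual_mul w dual_one = w.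
Proof. by apply: dual_ext => x /=; rewrite mulr1. Qed.

Lemma dual_mulV w : dual_mul w (dual_inv w) = dual_one.
Proof. by apply: dual_ext => x /=; rewrite dualVr. Qed.

(** Since characters have modulus 1, the error of a product is at most the sum of the errors of the
    factors, so the same compact set works with [e / 2]. *)
Lemma dual_mul_continuous :
  continuous (fun p : dual * dual => dual_mul p.1 p.2).
Proof.
move=> [a b] U /nbhs_dualP [C [e [cC e0] CU]].
have e2 : 0 < e / 2 by rewrite divr_gt0.
exists ([set w : dual | forall x, C x -> normc (w x - a x) < e / 2],
        [set w : dual | forall x, C x -> normc (w x - b x) < e / 2]).
  by split; exact: nbhs_dual.
move=> [v w] /= [hv hw]; apply: CU => x Cx /=.
rewrite (_ : _ - _ = (v x - a x) * w x + a x * (w x - b x)); last by ring.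
apply: le_lt_trans (normc_triangle _ _) _.
rewrite !Normc.normcM !dual_norm mulr1 mul1r (splitr e).
by apply: ltrD; [exact: hv|exact: hw].
Qed.

Lemma dual_inv_continuous : continuous dual_inv.
Proof.
move=> a U /nbhs_dualP [C [e [cC e0] CU]].
have := nbhs_dual a cC e0; apply: filterS => w hw; apply: CU => x Cx /=.
by rewrite !dualN -(rmorphB conjc) normc_conjc hw.
Qed.

Lemma dual_mull_continuous w : continuous (dual_mul w).
Proof.
move=> a U /nbhs_dualP [C [e [cC e0] CU]].
have := nbhs_dual a cC e0; apply: filterS => v hv; apply: CU => x Cx /=.
by rewrite -mulrBr Normc.normcM dual_norm mul1r hv.
Qed.

End dual_topology.

(** If [P K] failed, the sets whose complement in [K] satisfies [P] would form a proper filter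
    containing [K]. At a cluster point in [K] the local hypothesis puts the complement of a
    neighbourhood into that filter, a contradiction. *)
Lemma compact_union_ind (T : topologicalType) (P : set T -> Prop) (K : set T) :
  compact K -> P set0 ->
  (forall A B, P A -> P B -> P (A `|` B)) ->
  (forall A B, A `<=` B -> P B -> P A) ->
  (forall x, K x -> exists2 U, nbhs x U & P U) -> P K.
Proof.
move=> cK P0 PU PS Ploc; apply: contrapT => nPK.
pose F : set_system T := [set A | P (K `\` A)].
have FF : ProperFilter F.
  apply: Build_ProperFilter.
    by rewrite /F/= setD0.
  split.
  - by rewrite /F/= setDT.
  - by move=> A B; rewrite /F/= setDIr; exact: PU.
  - by move=> A B AB; apply: PS => x [Kx nB]; split=> // /AB.
have FK : F K by rewrite /F/= setDv.
have [x [Kx clx]] := cK F FF FK.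
have [U Ux PU'] := Ploc x Kx.
have FU : F (~` U) by apply: PS PU' => y [_ /= /contrapT].
by have [y [/= nUy Uy]] := clx _ _ FU Ux.
Qed.

Section borel_sets.
Context {T : ptopologicalType}.

Lemma borel_open (A : set T) : open A -> measurable (A : set (borel T)).
Proof. by move=> oA; apply: sub_sigma_algebra. Qed.

Lemma borel_closed (A : set T) : closed A -> measurable (A : set (borel T)).
Proof.
move=> cA; rewrite -[A]setCK; apply: measurableC.
by apply: borel_open; exact: closed_openC.
Qed.

Lemma borel_compact (A : set T) : hausdorff_space T -> compact A ->
  measurable (A : set (borel T)).
Proof. by move=> hT cA; apply: borel_closed; exact: compact_closed. Qed.

End borel_sets.

(** * Haar measure and local compactness of the dual *)

Section dual_haar.
Context {R : realType} {G : topologicalZmodType}.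
Local Notation dual := (dual R G).
Variable muD : {measure set (borel dual) -> \bar R}.
Hypothesis haarD : haar_measure (@dual_mul R G) muD.

Let measurable_compact (K : set dual) : compact K -> measurable (K : set (borel dual)).
Proof. by apply: borel_compact; exact: dual_hausdorff. Qed.

Lemma dual_compact_lty (K : set dual) : compact K -> (muD K < +oo)%E.
Proof. by case: haarD => -[h _ _] _ _; exact: h. Qed.

(** Translates of a null open set are null and finitely many cover any compact set, so compact sets
    would be null; inner regularity then makes the whole dual null. *)
Lemma dual_open_measure_gt0 (O : set dual) : open O -> O !=set0 -> (0 < muD O)%E.
Proof.
move=> oO [w0 Ow0]; rewrite lt_neqAle measure_ge0 andbT eq_sym; apply/negP => /eqP O0.
have [[_ _ inner] /negP T0 inv] := haarD; apply: T0.
rewrite eq_le measure_ge0 andbT (inner _ openT).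
apply: ge_ereal_sup => _ [K [cK _] <-].
have : muD.-negligible (K : set (borel dual)).
  apply: (compact_union_ind (P := fun A => muD.-negligible (A : set (borel dual))) cK).
  - exact: negligible_set0.
  - by move=> A B; exact: negligibleU.
  - by move=> A B AB; exact: negligibleS.
  (* Multiplication by [a] carries [k] to [w0], so the preimage of [O] is a translate containing
     [k]. *)
  move=> k Kk; pose a := dual_mul w0 (dual_inv k).
  exists (dual_mul a @^-1` O).
    apply: open_nbhs_nbhs; split.
      by apply: open_comp => // w _; exact: dual_mull_continuous.
    by rewrite /= /a -dual_mulA (dual_mulC _ k) dual_mulV dual_mul1.
  exists (dual_mul a @^-1` O); split => //.
    apply: borel_open; apply: open_comp => // w _; exact: dual_mull_continuous.
  by rewrite inv//; exact: borel_open.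
by move/negligibleP => -> //; exact: measurable_compact.
Qed.

(* Steinhaus: if K has positive finite measure then K K^-1 is a neighbourhood of 1. *)
Lemma dual_compact_nbhs1 : exists2 N : set dual, compact N & nbhs (dual_one : dual) N.
Proof.
have [[fin outer inner] T0 inv] := haarD.
have [K cK K0] : exists2 K : set dual, compact K & (0 < muD K)%E.
  apply: contrapT => h; move/negP : T0; apply; rewrite eq_le measure_ge0 andbT.
  rewrite (inner _ openT); apply: ge_ereal_sup => _ [K [cK _] <-].
  by rewrite leNgt; apply/negP => K0; apply: h; exists K.
have mK := measurable_compact cK.
have Kfin : muD K \is a fin_num by rewrite ge0_fin_numE// fin.
(* Outer regularity gives an open [U] of measure less than twice that of [K]: two translates of [K]
   inside [U] cannot be disjoint. *)
have [U [oU KU] UK] : exists2 U : set dual, open U /\ K `<=` U & (muD U < muD K + muD K)%E.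
  have : (muD K < muD K + muD K)%E by rewrite lteDl.
  rewrite {1}(outer _ mK) => /ereal_inf_lt [_ [U [oU KU] <-] h].
  by exists U.
exists ((fun p : dual * dual => dual_mul p.1 (dual_inv p.2)) @` (K `*` K)).
  apply: continuous_compact; last exact: compact_setX.
  apply: continuous_subspaceT => p.
  apply: (@continuous_comp _ _ _ (fun p : dual * dual => (p.1, dual_inv p.2))
    (fun p : dual * dual => dual_mul p.1 p.2)); last exact: dual_mul_continuous.
  move=> V [[A B] /= [nA nB] AB]; exists (A, dual_inv @^-1` B) => /=.
    by split => //; exact: dual_inv_continuous.
  by move=> q [Aq Bq]; exact: AB.
(* Tube argument: as [K] is compact and [U] open, the translate of [K] by any [w] close enough to 1
   still lies in [U]. *)
have /compact_near_coveringP/(_ _ (nbhs (dual_one : dual))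
  (fun w k => U (dual_mul w k)) _) near := cK.
have : \forall w \near (dual_one : dual), K `<=` (fun k => U (dual_mul w k)).
  apply: near => k Kk.
  have Uk : nbhs (dual_mul dual_one k) U.
    by apply: open_nbhs_nbhs; split=> //; rewrite dual_mulC dual_mul1; exact: KU.
  have [[A B] /= [nA nB] AB] := @dual_mul_continuous R G (dual_one, k) _ Uk.
  by exists (B, A) => // -[k' w] [/= Bk' Aw]; exact: (AB (w, k')).
apply: filterS => w KwU.
pose wK := dual_mul (dual_inv w) @^-1` K.
have wKU : wK `<=` U.
  move=> v /= /KwU; rewrite dual_mulA dual_mulV dual_mulC dual_mul1.
  exact.
have mwK : measurable (wK : set (borel dual)).
  apply: borel_closed; apply: closed_comp; last exact: compact_closed dual_hausdorff cK.
  by move=> v _; exact: dual_mull_continuous.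
have [v [wKv Kv]] : (wK `&` K) !=set0.
  apply/set0P/negP => /eqP d0; move: UK; apply/negP; rewrite -leNgt.
  rewrite -{1}(inv (dual_inv w) K mK) -measureU//.
  apply: le_measure; rewrite ?inE//; first exact: measurableU.
    exact: borel_open.
  by rewrite subUset.
(* With [v] in both [K] and its translate by [w], the quotient of [v] by [dual_mul (dual_inv w) v]
   is [w]. *)
exists (v, dual_mul (dual_inv w) v); first by split.
rewrite /=; apply: dual_ext => x /=; rewrite opprK.
by rewrite mulrCA dualVr mulr1.
Qed.

Lemma dual_compact_nbhs (w : dual) : exists2 N : set dual, compact N & nbhs w N.
Proof.
have [N cN N1] := dual_compact_nbhs1.
exists (dual_mul w @` N).
  apply: continuous_compact => //; apply: continuous_subspaceT.
  exact: dual_mull_continuous.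
have h : nbhs w (dual_mul (dual_inv w) @^-1` N).
  by apply: (@dual_mull_continuous R G (dual_inv w) w); rewrite dual_mulC dual_mulV.
apply: filterS h => v Nv.
exists (dual_mul (dual_inv w) v) => //.
by rewrite dual_mulA dual_mulV dual_mulC dual_mul1.
Qed.

End dual_haar.

(** * Integration of complex-valued functions *)

Section complex_integral.
Context {R : realType} {d : measure_display} {T : measurableType d}.
Implicit Types (f g : T -> R[i]) (mu : {measure set T -> \bar R}).

Lemma Lp1_integrable mu f : Lp mu 1%:E f ->
  mu.-integrable setT (EFin \o (fun x => complex.Re (f x))) /\
  mu.-integrable setT (EFin \o (fun x => complex.Im (f x))).
Proof.
move=> /Lp1P[mf fi].
have ni : mu.-integrable setT (EFin \o (fun x => normc (f x))).
  apply/integrableP; split.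
    by apply/measurable_EFinP; exact: cmeasurable_normc.
  rewrite (eq_integral (fun x => (normc (f x))%:E))// => x _.
  by rewrite /= ger0_norm ?normc_ge0.
split; apply: (le_integrable _ _ _ ni) => //.
- by apply/measurable_EFinP; exact: mf.1.
- by move=> x _ /=; rewrite lee_fin (ger0_norm (normc_ge0 _)) ler_Re_normc.
- by apply/measurable_EFinP; exact: mf.2.
- by move=> x _ /=; rewrite lee_fin (ger0_norm (normc_ge0 _)) ler_Im_normc.
Qed.

Lemma cintegralD mu f g : Lp mu 1%:E f -> Lp mu 1%:E g ->
  cintegral mu (fun x => f x + g x) = cintegral mu f + cintegral mu g.
Proof.
move=> /Lp1_integrable[fr fi] /Lp1_integrable[gr gi]; rewrite /cintegral.
rewrite [RHS]/GRing.add /=; congr Complex.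
  rewrite -RintegralD//; apply: eq_Rintegral => x _.
  by case: (f x) (g x) => [? ?] [? ?].
rewrite -RintegralD//; apply: eq_Rintegral => x _.
by case: (f x) (g x) => [? ?] [? ?].
Qed.

Lemma cintegralZ mu (c : R[i]) f : Lp mu 1%:E f ->
  cintegral mu (fun x => c * f x) = c * cintegral mu f.
Proof.
move=> /Lp1_integrable[fr fi]; rewrite /cintegral; case: c => a b.
rewrite [RHS]/GRing.mul /=; congr Complex.
  rewrite -!RintegralZl// -RintegralB//; last 2 first.
  - by apply: (integrableZl measurableT a fr).
  - by apply: (integrableZl measurableT b fi).
  by apply: eq_Rintegral => x _; case: (f x) => [? ?].
rewrite -!RintegralZl// -RintegralD//; last 2 first.
- by apply: (integrableZl measurableT a fi).
- by apply: (integrableZl measurableT b fr).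
by apply: eq_Rintegral => x _; case: (f x) => [? ?].
Qed.

Lemma eq_cintegral mu f g : (forall x, f x = g x) -> cintegral mu f = cintegral mu g.
Proof. by move=> /funext ->. Qed.

(** The real and imaginary parts are estimated separately, whence the factor 2; the estimate only
    serves to show boundedness of Fourier transforms. *)
Lemma normc_cintegral_le mu f : Lp mu 1%:E f ->
  normc (cintegral mu f) <= 2 * fine (\int[mu]_x (normc (f x))%:E)%E.
Proof.
move=> f1; have [fr fi] := Lp1_integrable f1; have /Lp1P[mf fl] := f1.
have ni : mu.-integrable setT (EFin \o (fun x => normc (f x))).
  apply/integrableP; split.
    by apply/measurable_EFinP; exact: cmeasurable_normc.
  rewrite (eq_integral (fun x => (normc (f x))%:E))// => x _.
  by rewrite /= ger0_norm ?normc_ge0.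
apply: (le_trans (normc_le_ReIm _)) => /=; rewrite mulr_natl mulr2n.
apply: lerD; apply: (le_trans (le_normr_Rintegral _ _)) => //.
- apply: le_Rintegral => //.
    by apply: (integrable_abse fr).
  by move=> x _; exact: ler_Re_normc.
- apply: le_Rintegral => //.
    by apply: (integrable_abse fi).
  by move=> x _; exact: ler_Im_normc.
Qed.

Lemma Lp1D mu f g : Lp mu 1%:E f -> Lp mu 1%:E g -> Lp mu 1%:E (fun x => f x + g x).
Proof.
move=> /Lp1P[mf fi] /Lp1P[mg gi]; apply/Lp1P; split; first exact: cmeasurableD.
apply: (@le_lt_trans _ _ (\int[mu]_x ((normc (f x))%:E + (normc (g x))%:E))%E).
  apply: ge0_le_integral => //.
  - by move=> x _; rewrite lee_fin normc_ge0.
  - by apply/measurable_EFinP; apply: cmeasurable_normc; exact: cmeasurableD.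
  - by apply: emeasurable_funD; apply/measurable_EFinP; exact: cmeasurable_normc.
  - by move=> x _; rewrite -EFinD lee_fin normc_triangle.
rewrite ge0_integralD//; first exact: lte_add_pinfty.
- by move=> x _; rewrite lee_fin normc_ge0.
- by apply/measurable_EFinP; exact: cmeasurable_normc.
- by move=> x _; rewrite lee_fin normc_ge0.
- by apply/measurable_EFinP; exact: cmeasurable_normc.
Qed.

Lemma Lp1_bounded mu (c : T -> R[i]) (M : R) f : cmeasurable c ->
  (forall x, normc (c x) <= M) -> Lp mu 1%:E f -> Lp mu 1%:E (fun x => c x * f x).
Proof.
move=> mc cM /Lp1P[mf fi]; apply/Lp1P; split; first exact: cmeasurableM.
apply: (@le_lt_trans _ _ (\int[mu]_x (M%:E * (normc (f x))%:E))%E).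
  apply: ge0_le_integral => //.
  - by move=> x _; rewrite lee_fin normc_ge0.
  - by apply/measurable_EFinP; apply: cmeasurable_normc; exact: cmeasurableM.
  - by apply: emeasurable_funM => //; apply/measurable_EFinP; exact: cmeasurable_normc.
  - by move=> x _; rewrite -EFinM lee_fin Normc.normcM ler_wpM2r ?normc_ge0.
(* A negative bound on a modulus is possible only on an empty space, where the integral is zero. *)
have [M0|M0] := leP 0 M.
  rewrite ge0_integralZl//; first by rewrite lte_mul_pinfty.
  - by apply/measurable_EFinP; exact: cmeasurable_normc.
  - by move=> x _; rewrite lee_fin normc_ge0.
rewrite (@le_lt_trans _ _ 0%E)//; apply: (@le_trans _ _ (\int[mu]_x (cst 0%E x))%E); last by rewrite integral0.
apply: ge0_le_integral => //.
- by move=> x _; have := le_lt_trans (cM x) M0; rewrite ltNge normc_ge0.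
- by apply: emeasurable_funM => //; apply/measurable_EFinP; exact: cmeasurable_normc.
- by move=> x _; have := le_lt_trans (cM x) M0; rewrite ltNge normc_ge0.
Qed.

Lemma nsq_bounded mu (c : T -> R[i]) (M : R) f : cmeasurable c -> cmeasurable f ->
  (forall x, normc (c x) <= M) ->
  (nsq mu (fun x => c x * f x)%R <= (M ^+ 2)%:E * nsq mu f)%E.
Proof.
move=> mc mf cM; rewrite /nsq -ge0_integralZl//; last 3 first.
- exact: measurable_nsq.
- by move=> x _; rewrite lee_fin sqr_ge0.
- by rewrite lee_fin sqr_ge0.
apply: ge0_le_integral => //.
- by move=> x _; rewrite lee_fin sqr_ge0.
- by apply: measurable_nsq; exact: cmeasurableM.
- by apply: emeasurable_funM => //; exact: measurable_nsq.
- move=> x _; rewrite -EFinM lee_fin Normc.normcM exprMn ler_wpM2r ?sqr_ge0//.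
  by rewrite ler_pXn2r ?nnegrE ?normc_ge0//; exact: le_trans (normc_ge0 _) (cM x).
Qed.

Lemma Lp2_bounded mu (c : T -> R[i]) (M : R) f : cmeasurable c ->
  (forall x, normc (c x) <= M) -> Lp mu 2%:E f -> Lp mu 2%:E (fun x => c x * f x).
Proof.
move=> mc cM /Lp2P[mf fi]; apply/Lp2P; split; first exact: cmeasurableM.
apply: le_lt_trans (nsq_bounded mu mc mf cM) _.
by rewrite lte_mul_pinfty ?lee_fin ?sqr_ge0.
Qed.

Lemma Lp2D mu f g : Lp mu 2%:E f -> Lp mu 2%:E g -> Lp mu 2%:E (fun x => f x + g x).
Proof.
move=> /Lp2P[mf fi] /Lp2P[mg gi]; apply/Lp2P; split; first exact: cmeasurableD.
apply: le_lt_trans (nsqD mu mf mg) _.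
by apply: lte_add_pinfty; rewrite lte_mul_pinfty.
Qed.

Lemma LpZ mu (c : R[i]) f : Lp mu 1%:E f /\ Lp mu 2%:E f ->
  Lp mu 1%:E (fun x => c * f x) /\ Lp mu 2%:E (fun x => c * f x).
Proof.
move=> [f1 f2]; split.
  exact: (Lp1_bounded (cmeasurable_cst c) (fun=> lexx (normc c)) f1).
exact: (Lp2_bounded (cmeasurable_cst c) (fun=> lexx (normc c)) f2).
Qed.

Lemma LpD mu f g : Lp mu 1%:E f /\ Lp mu 2%:E f -> Lp mu 1%:E g /\ Lp mu 2%:E g ->
  Lp mu 1%:E (fun x => f x + g x) /\ Lp mu 2%:E (fun x => f x + g x).
Proof. by move=> [? ?] [? ?]; split; [exact: Lp1D|exact: Lp2D]. Qed.

Lemma LpB mu f g : Lp mu 1%:E f /\ Lp mu 2%:E f -> Lp mu 1%:E g /\ Lp mu 2%:E g ->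
  Lp mu 1%:E (fun x => f x - g x) /\ Lp mu 2%:E (fun x => f x - g x).
Proof.
move=> Lf Lg; have := LpD Lf (LpZ (-1) Lg).
by under eq_fun do rewrite mulN1r.
Qed.

End complex_integral.

(** * Measurability of integrals in a parameter *)

Section parameter_integral.
Context {R : realType} {dX dY : measure_display}.
Context {X : measurableType dX} {Y : measurableType dY}.

(** An alias of [m] that carries the proof of sigma-finiteness, so that it can be given the
    structure which Tonelli's theorem asks for. *)
Definition sigma_finite_of (m : {measure set Y -> \bar R})
  (_ : sigma_finite setT m) : set Y -> \bar R := m.
HB.instance Definition _ (m : {measure set Y -> \bar R}) (sf : sigma_finite setT m) :=
  Measure.on (sigma_finite_of sf).
HB.instance Definition _ (m : {measure set Y -> \bar R}) (sf : sigma_finite setT m) :=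
  Measure_isSigmaFinite.Build _ _ _ (sigma_finite_of sf) sf.

(** Tonelli's theorem is applied to the positive and negative parts separately, so the sections may
    fail to be integrable; [fine] then gives a conventional value. *)
Lemma measurable_Rintegral_param (m : {measure set Y -> \bar R}) (u : X * Y -> R) :
  sigma_finite setT m -> measurable_fun setT u ->
  measurable_fun setT (fun x => (\int[m]_y u (x, y))%R).
Proof.
move=> sf mu.
pose m' : {sigma_finite_measure set Y -> \bar R} := sigma_finite_of sf.
have mue : measurable_fun setT (EFin \o u) by exact/measurable_EFinP.
apply: (@measurableT_comp _ _ _ _ _ _ fine); first exact: fine_measurable.
rewrite (_ : (fun x => _) = (fun x => (\int[m']_y ((EFin \o u)^\+ (x, y)) -
    \int[m']_y ((EFin \o u)^\- (x, y)))%E)).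
  apply: emeasurable_funB.
    apply: (measurable_fun_fubini_tonelli_F (m2 := m') (EFin \o u)^\+%E) => //.
    exact: measurable_funepos.
  apply: (measurable_fun_fubini_tonelli_F (m2 := m') (EFin \o u)^\-%E) => //.
  exact: measurable_funeneg.
apply/funext => x.
rewrite integralE; congr (_ - _)%E; rewrite /m' /sigma_finite_of;
  by apply: eq_integral => y _; rewrite ?funeposE ?funenegE.
Qed.

Lemma cmeasurable_cintegral (m : {measure set Y -> \bar R}) (f : X * Y -> R[i]) :
  sigma_finite setT m -> cmeasurable f ->
  cmeasurable (fun x => cintegral m (fun y => f (x, y))).
Proof.
move=> sf [f1 f2]; split => /=.
  exact: (measurable_Rintegral_param sf f1).
exact: (measurable_Rintegral_param sf f2).
Qed.

End parameter_integral.

(** * Countable bases and Borel measurability *)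

Section countable_base.
Context {R : realType}.

Lemma second_countable_seq (T : topologicalType) : @second_countable T ->
  exists e : nat -> set T, (forall n, open (e n)) /\
    forall x U, nbhs x U -> exists n, e n x /\ e n `<=` U.
Proof.
move=> [B cB [Bo Bn]].
have /countable_injP[f finj] := cB.
(* The base is enumerated through an injection into the natural numbers; numbers outside its range
   receive the empty set. *)
pose e n := xget (set0 : set T) [set A | B A /\ f A = n].
exists e; split.
  move=> n; rewrite /e; case: xgetP => [A _ [BA _]|_]; [exact: Bo|exact: open0].
move=> x U /Bn [A [BA Ax] AU]; exists (f A).
have -> : e (f A) = A; last by [].
rewrite /e; case: xgetP => [A' _ [BA' fA]|/(_ A)]; last by case.
by apply: finj; rewrite ?inE.
Qed.

Lemma borel_measurable_fun_gt (d : measure_display) (X : measurableType d) (f : X -> R) :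
  (forall a, measurable [set x | a < f x]) -> measurable_fun setT f.
Proof.
move=> h; apply: (measurability _ (RGenOInfty.measurableE R)).
move=> _ [_ [a ->] <-]; rewrite setTI.
by rewrite (_ : _ @^-1` _ = [set x | a < f x])//; apply/seteqP; split=> x /=;
  rewrite in_itv/= andbT.
Qed.

Lemma continuous_borel (T : ptopologicalType) (f : T -> R) : continuous f ->
  measurable_fun setT (f : borel T -> R).
Proof.
move=> cf; apply: borel_measurable_fun_gt => a; apply: borel_open.
rewrite (_ : [set x | a < f x] = f @^-1` [set y | a < y]); last by [].
by apply: open_comp => [x _|]; [exact: cf|exact: open_gt].
Qed.

(** [u x y] exceeds [a] exactly when, for some [m] and some basic open set around [y], the function
    [u x] is at least [a + m.+1%:R^-1] on that whole set. The admissible [x] form a closed set, so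
    countably many measurable rectangles suffice and measurability holds for the product of the
    Borel sigma-algebras. *)
Lemma separately_continuous_borel (X Y : ptopologicalType) (u : X -> Y -> R) :
  @second_countable Y -> (forall y, continuous (u^~ y)) -> (forall x, continuous (u x)) ->
  measurable_fun setT (fun z : borel X * borel Y => u z.1 z.2).
Proof.
move=> /second_countable_seq[e [eo en]] cX cY; apply: borel_measurable_fun_gt => a.
pose F n m : set X := [set x | forall y, e n y -> a + m.+1%:R^-1 <= u x y].
rewrite (_ : [set _ | _] = \bigcup_n \bigcup_m ((F n m : set (borel X)) `*` (e n : set (borel Y)))).
  apply: bigcupT_measurable => n; apply: bigcupT_measurable => m.
  apply: measurableX; last exact: borel_open.
  apply: borel_closed.
  rewrite (_ : F n m = \bigcap_(y in e n) [set x | a + m.+1%:R^-1 <= u x y]); last by [].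
  apply: closed_bigI => y _.
  rewrite (_ : [set x | _] = (u^~ y) @^-1` [set r | a + m.+1%:R^-1 <= r]); last by [].
  by apply: closed_comp => [x _|]; [exact: cX|exact: closed_ge].
apply/seteqP; split => [[x y]/= axy|[x y] [n _ [m _ [/= Fx ey]]]]; last first.
  by rewrite /=; apply: lt_le_trans (Fx _ ey); rewrite ltrDl.
have [m /= hm] : exists m, a + m.+1%:R^-1 < u x y by exact: ltr_add_invr.
have : nbhs y [set y' | a + m.+1%:R^-1 < u x y'].
  have : nbhs (u x y) [set r | a + m.+1%:R^-1 < r].
    by apply: open_nbhs_nbhs; split => //; exact: open_gt.
  by move=> /(cY x y).
move=> /en[n [eny enU]]; exists n => //; exists m => //; split => //=.
by move=> y' /enU /= /ltW.
Qed.

End countable_base.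

(** * The Fourier transform *)

Section haar.
Context {R : realType} {G : topologicalZmodType}.
Variable muG : {measure set (borelG G) -> \bar R}.
Hypothesis muG_haar : @haar_measure R (pointed_group G) +%R muG.

(** The basic open sets of finite measure already cover [G], since every point has a basic
    neighbourhood inside a compact set. *)
Lemma haar_sigma_finite : locally_compact [set: G] -> @second_countable G ->
  sigma_finite [set: borelG G] muG.
Proof.
move=> G_locally_compact G_second_countable.
have [e [eo en]] := second_countable_seq G_second_countable.
pose F n : set (borelG G) := if (muG (e n) < +oo)%E then e n else set0.
exists F; last first.
  move=> n; rewrite /F; case: ifPn => h; last by rewrite measure0 ltry.
  by split => //; apply: borel_open; exact: eo.
apply/seteqP; split => // x _.
have [C + [cC clC]] := G_locally_compact x I.
rewrite withinET => /en[n [enx enC]]; exists n => //; rewrite /F ifT//.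
have [[cfin _ _] _ _] := muG_haar.
apply: le_lt_trans (cfin _ cC); apply: le_measure; rewrite ?inE//.
  by apply: borel_open; exact: eo.
exact: borel_closed.
Qed.

Lemma measurable_shift (a : G) : measurable_fun setT (fun x : borelG G => (a + x : borelG G)).
Proof.
apply: (@measurability _ _ (borelG G) (borelG G) setT _ (@open (pointed_group G))) => // _ [U oU <-].
rewrite setTI; apply: borel_open; apply: open_comp => // x _.
apply: (@continuous_comp G (G * G)%type G (fun x => (a, x)) (fun p => p.1 + p.2)).
  apply: (@cvg_pair _ _ _ _ (nbhs a) (nbhs x)); [exact: cvg_cst|exact: cvg_id].
exact: add_continuous.
Qed.

Lemma ge0_integral_shift (a : G) (f : borelG G -> \bar R) :
  measurable_fun setT f -> (forall x, (0 <= f x)%E) ->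
  (\int[muG]_x f (a + x)%R = \int[muG]_x f x)%E.
Proof.
move=> mf f0.
have := @ge0_integral_pushforward _ _ _ _ R _ (measurable_shift a) muG setT f measurableT mf (fun x _ => f0 x).
rewrite preimage_setT /= => <-.
apply: eq_measure_integral; first exact: measurable_shift.
move=> ms A mA _.
by have [_ _ inv] := muG_haar; exact: inv.
Qed.

Lemma Rintegral_shift (a : G) (f : borelG G -> R) :
  measurable_fun setT f -> (\int[muG]_x f (a + x) = \int[muG]_x f x)%R.
Proof.
move=> mf; have mfe : measurable_fun setT (EFin \o f) by exact/measurable_EFinP.
congr fine; rewrite [LHS]integralE [RHS]integralE; congr (_ - _)%E.
  transitivity (\int[muG]_x ((EFin \o f)^\+ (a + x)%R))%E.
    by apply: eq_integral => x _; rewrite !funeposE.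
  rewrite (@ge0_integral_shift a ((EFin \o f)^\+)%E)//; exact: measurable_funepos.
transitivity (\int[muG]_x ((EFin \o f)^\- (a + x)%R))%E.
  by apply: eq_integral => x _; rewrite !funenegE.
rewrite (@ge0_integral_shift a ((EFin \o f)^\-)%E)//; exact: measurable_funeneg.
Qed.

Lemma cmeasurable_shift (a : G) (f : borelG G -> R[i]) : cmeasurable f ->
  cmeasurable (fun x : borelG G => f (a + x)).
Proof.
move=> [f1 f2]; split.
  exact: (measurableT_comp f1 (measurable_shift a)).
exact: (measurableT_comp f2 (measurable_shift a)).
Qed.

Lemma cintegral_shift (a : G) (f : borelG G -> R[i]) : cmeasurable f ->
  cintegral muG (fun x => f (a + x)) = cintegral muG f.
Proof.
move=> [f1 f2]; congr Complex.
  exact: (Rintegral_shift a f1).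
exact: (Rintegral_shift a f2).
Qed.

Lemma Lp_shift (a : G) (f : borelG G -> R[i]) :
  Lp muG 1%:E f /\ Lp muG 2%:E f ->
  Lp muG 1%:E (fun x : borelG G => f (a + x)) /\ Lp muG 2%:E (fun x : borelG G => f (a + x)).
Proof.
move=> [/Lp1P[mf f1] /Lp2P[_ f2]]; split; [apply/Lp1P|apply/Lp2P];
  (split; first exact: cmeasurable_shift).
  rewrite (@ge0_integral_shift a (fun x => (normc (f x))%:E))//.
    by apply/measurable_EFinP; exact: cmeasurable_normc.
  by move=> x; rewrite lee_fin normc_ge0.
rewrite /nsq (@ge0_integral_shift a (fun x => (normc (f x) ^+ 2)%:E))//.
  exact: measurable_nsq.
by move=> x; rewrite lee_fin sqr_ge0.
Qed.

End haar.

Section fourier.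
Context {R : realType} {G : topologicalZmodType}.
Variable muG : {measure set (borelG G) -> \bar R}.
Local Notation dual := (dual R G).
Implicit Types (f g : borelG G -> R[i]) (w : dual).

Lemma cmeasurable_dual w : cmeasurable (fun x : borelG G => w x).
Proof.
have hr : continuous (fun x : pointed_group G => complex.Re (w x)).
  exact: dual_Re_continuous2 w.
have hi : continuous (fun x : pointed_group G => complex.Im (w x)).
  exact: dual_Im_continuous2 w.
by split; [exact: (continuous_borel hr)|exact: (continuous_borel hi)].
Qed.

Lemma cmeasurable_eval (x : G) : cmeasurable (fun w : borel dual => (w : dual) x).
Proof.
have hr : continuous (fun w : dual => complex.Re (w x)) by exact: dual_Re_continuous.
have hi : continuous (fun w : dual => complex.Im (w x)) by exact: dual_Im_continuous.
by split; [exact: (continuous_borel hr)|exact: (continuous_borel hi)].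
Qed.

Lemma Lp1_fourier_integrand f w : Lp muG 1%:E f ->
  Lp muG 1%:E (fun x => f x * conjc (w x)).
Proof.
move=> f1; under eq_fun do rewrite mulrC.
apply: (Lp1_bounded (M := 1)) f1.
  by apply: cmeasurableJ; exact: cmeasurable_dual.
by move=> x; rewrite normc_conjc dual_norm.
Qed.

Lemma fourierD f g w : Lp muG 1%:E f -> Lp muG 1%:E g ->
  fourier muG (fun x => f x + g x) w = fourier muG f w + fourier muG g w.
Proof.
move=> f1 g1; rewrite /fourier -cintegralD; try exact: Lp1_fourier_integrand.
by apply: eq_cintegral => x; rewrite mulrDl.
Qed.

Lemma fourierZ (c : R[i]) f w : Lp muG 1%:E f ->
  fourier muG (fun x => c * f x) w = c * fourier muG f w.
Proof.
move=> f1; rewrite /fourier -cintegralZ; last exact: Lp1_fourier_integrand.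
by apply: eq_cintegral => x; rewrite mulrA.
Qed.

Lemma fourierB f g w : Lp muG 1%:E f -> Lp muG 1%:E g ->
  fourier muG (fun x => f x - g x) w = fourier muG f w - fourier muG g w.
Proof.
move=> f1 g1; rewrite -mulN1r -fourierZ// -fourierD//.
  by apply: eq_cintegral => x; rewrite mulN1r.
exact: (Lp1_bounded (cmeasurable_cst (-1)) (fun=> lexx (normc (-1))) g1).
Qed.

Lemma fourier_shift (a : G) f w :
  @haar_measure R (pointed_group G) +%R muG -> Lp muG 1%:E f ->
  fourier muG (fun x => f (a + x)) w = w a * fourier muG f w.
Proof.
move=> haarG f1; have [mf _] := f1.
rewrite /fourier -cintegralZ; last exact: Lp1_fourier_integrand.
(* Shifting the integrand on the right by [a] produces a factor [conjc (w a)], which cancels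
   [w a]. *)
rewrite -[RHS](cintegral_shift haarG a).
  apply: eq_cintegral => x; rewrite dual_add (rmorphM conjc) [RHS]mulrCA.
  by rewrite (mulrA (w a)) mulr_conjc_norm1 ?dual_norm// mul1r.
apply: cmeasurableM; first exact: cmeasurable_cst.
by apply: cmeasurableM => //; apply: cmeasurableJ; exact: cmeasurable_dual.
Qed.

Lemma normc_fourier_le f w : Lp muG 1%:E f ->
  normc (fourier muG f w) <= 2 * fine (\int[muG]_x (normc (f x))%:E)%E.
Proof.
move=> f1; apply: le_trans (normc_cintegral_le (Lp1_fourier_integrand w f1)) _.
rewrite ler_pM2l// le_eqVlt; apply/orP; left; apply/eqP; congr fine.
by apply: eq_integral => x _; rewrite Normc.normcM normc_conjc dual_norm mulr1.
Qed.

Hypothesis G_second_countable : @second_countable G.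
Hypothesis muG_sigma_finite : sigma_finite [set: borelG G] muG.

Lemma cmeasurable_pairing :
  cmeasurable (fun z : borel dual * borelG G => (z.1 : dual) z.2).
Proof.
split.
  apply: (@separately_continuous_borel R dual (pointed_group G)
    (fun w x => complex.Re (w x))) => //.
    by move=> x; exact: dual_Re_continuous.
  by move=> w; exact: dual_Re_continuous2.
apply: (@separately_continuous_borel R dual (pointed_group G)
  (fun w x => complex.Im (w x))) => //.
  by move=> x; exact: dual_Im_continuous.
by move=> w; exact: dual_Im_continuous2.
Qed.

Lemma cmeasurable_comp {d d' : measure_display} {X : measurableType d}
    {Y : measurableType d'} (f : Y -> R[i]) (h : X -> Y) :
  cmeasurable f -> measurable_fun setT h -> cmeasurable (fun x => f (h x)).
Proof.
by move=> [f1 f2] mh; split; [exact: (measurableT_comp f1)|exact: (measurableT_comp f2)].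
Qed.

Lemma cmeasurable_fourier_param {d : measure_display} {P : measurableType d}
    (g : P * borelG G -> R[i]) : cmeasurable g ->
  cmeasurable (fun z : P * borel dual => fourier muG (fun x => g (z.1, x)) z.2).
Proof.
move=> mg.
apply: (cmeasurable_cintegral (X := (P * borel dual)%type) (Y := borelG G)
  (f := fun t : (P * borel dual) * borelG G => g (t.1.1, t.2) * conjc ((t.1.2 : dual) t.2))) => //.
apply: cmeasurableM.
  apply: (cmeasurable_comp (h := fun t : (P * borel dual) * borelG G => (t.1.1, t.2)) mg).
  apply: measurable_fun_pair => //.
  by apply: measurableT_comp measurable_fst.
apply: cmeasurableJ.
apply: (cmeasurable_comp (h := fun t : (P * borel dual) * borelG G => (t.1.2, t.2)) cmeasurable_pairing).
apply: measurable_fun_pair => //.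
by apply: measurableT_comp measurable_fst.
Qed.

Lemma cmeasurable_fourier f : cmeasurable f ->
  cmeasurable (fourier muG f : borel dual -> R[i]).
Proof.
move=> mf.
have := @cmeasurable_fourier_param _ unit (fun z => f z.2) (cmeasurable_comp mf measurable_snd).
move=> /(cmeasurable_comp (h := fun w : borel dual => (tt, w))); apply.
by apply: measurable_fun_pair.
Qed.

End fourier.

(** * Jointly measurable transforms *)

Section geometric_nsq.
Context {R : realType} {d : measure_display} {T : measurableType d}.
Variable mu : {measure set T -> \bar R}.

Lemma nsq_geometric_cvg0 (f : nat -> T -> R[i]) :
  (forall k, (nsq mu (f k) <= ((8^-1 ^+ k)%R)%:E)%E) ->
  nsq mu (f k) @[k --> \oo] --> 0%E.
Proof.
move=> h; apply/ge0_cvge0P => [n|e e0]; first exact: nsq_ge0.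
have : (fun k => 8^-1 ^+ k : R) @ \oo --> (0 : R).
  by apply: cvg_expr; rewrite ger0_norm// invf_lt1// ltr1n.
move=> /cvgrPdist_lt/(_ _ e0); apply: filterS => k.
rewrite sub0r normrN ger0_norm ?exprn_ge0// => k8.
by apply: le_lt_trans (h k) _; rewrite lte_fin.
Qed.

Lemma nsq_cvg0_lt (f : nat -> T -> R[i]) (e : R) :
  nsq mu (f k) @[k --> \oo] --> 0%E -> 0 < e ->
  \forall k \near \oo, (nsq mu (f k) < e%:E)%E.
Proof.
move=> f0 e0; have /ge0_cvge0P := f0.
by move=> /(_ (fun n => nsq_ge0 _ _))/(_ e e0).
Qed.

Lemma nsq_lt_double (f g h : T -> R[i]) (e : R) :
  cmeasurable f -> cmeasurable g -> cmeasurable h ->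
  (nsq mu (fun w => f w - g w)%R < (e / 4)%:E)%E ->
  (nsq mu (fun w => g w - h w)%R < (e / 4)%:E)%E ->
  (nsq mu (fun w => f w - h w)%R < e%:E)%E.
Proof.
move=> mf mg mh fg gh; apply: le_lt_trans (nsq_tri mu mf mg mh) _.
rewrite (_ : e%:E = (2%:E * (e / 4)%:E + 2%:E * (e / 4)%:E)%E).
  by apply: lteD; rewrite lte_pmul2l.
by rewrite -!EFinM -EFinD; congr EFin; field.
Qed.

Lemma cmeasurable_glue (N : T -> nat) (f : nat -> T -> R[i]) :
  (forall n, measurable [set x | N x = n]) -> (forall n, cmeasurable (f n)) ->
  cmeasurable (fun x => f (N x) x).
Proof.
move=> mN mf; split; apply: borel_measurable_fun_gt => a.
  rewrite (_ : [set _ | _] = \bigcup_n ([set x | N x = n] `&`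
      (fun x => complex.Re (f n x)) @^-1` [set r | a < r])).
    apply: bigcupT_measurable => n; apply: measurableI => //.
    rewrite -[X in measurable X]setTI; apply: (mf n).1 => //.
    by rewrite -set_itvoy; exact: measurable_itv.
  by apply/seteqP; split => [x /= h|x [n _ /= [<-]]//]; exists (N x).
rewrite (_ : [set _ | _] = \bigcup_n ([set x | N x = n] `&`
    (fun x => complex.Im (f n x)) @^-1` [set r | a < r])).
  apply: bigcupT_measurable => n; apply: measurableI => //.
  rewrite -[X in measurable X]setTI; apply: (mf n).2 => //.
  by rewrite -set_itvoy; exact: measurable_itv.
by apply/seteqP; split => [x /= h|x [n _ /= [<-]]//]; exists (N x).
Qed.

End geometric_nsq.

(** * Truncation to sets of finite measure *)

Section truncation.
Context {R : realType} {d : measure_display} {T : measurableType d}.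
Variable mu : {measure set T -> \bar R}.

Definition trunc (A : set T) (f : T -> R[i]) (x : T) : R[i] := (\1_A x)%:C%C * f x.

Lemma normc_indic (A : set T) (x : T) : normc ((\1_A x)%:C%C : R[i]) <= 1.
Proof.
rewrite /= expr0n addr0 sqrtr_sqr indicE; case: (x \in A) => /=.
  by rewrite normr1.
by rewrite normr0.
Qed.

Lemma cmeasurable_indic (A : set T) : measurable A ->
  cmeasurable (fun x => (\1_A x)%:C%C : R[i]).
Proof. by move=> mA; apply: cmeasurable_real; exact: measurable_indic. Qed.

(** Integrability follows from [t <= 1 + t^2]: the modulus is dominated by the indicator of [A] plus
    the square of the modulus of [f]. *)
Lemma trunc_Lp (A : set T) (f : T -> R[i]) : measurable A -> (mu A < +oo)%E ->
  Lp mu 2%:E f -> Lp mu 1%:E (trunc A f) /\ Lp mu 2%:E (trunc A f).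
Proof.
move=> mA Afin f2; have /Lp2P[mf fi] := f2.
have mA' := cmeasurable_indic mA; split; last first.
  exact: (Lp2_bounded mA' (normc_indic A) f2).
apply/Lp1P; split; first exact: cmeasurableM.
apply: (@le_lt_trans _ _ (\int[mu]_x ((\1_A x)%:E + (normc (f x) ^+ 2)%:E))%E).
  apply: ge0_le_integral => //.
  - by move=> x _; rewrite lee_fin normc_ge0.
  - by apply/measurable_EFinP; apply: cmeasurable_normc; exact: cmeasurableM.
  - apply: emeasurable_funD; last exact: measurable_nsq.
    by apply/measurable_EFinP; exact: measurable_indic.
  - move=> x _; rewrite -EFinD lee_fin /trunc Normc.normcM indicE.
    case: (x \in A) => /=.
      rewrite expr1n expr0n addr0 sqrtr1 mul1r.
      have := sqr_ge0 (normc (f x) - 1); have := normc_ge0 (f x).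
      rewrite !expr2; nra.
    by rewrite expr0n addr0 sqrtr0 mul0r add0r sqr_ge0.
rewrite ge0_integralD//.
- by apply: lte_add_pinfty => //; rewrite integral_indic// setIT.
- by apply/measurable_EFinP; exact: measurable_indic.
- by move=> x _; rewrite lee_fin sqr_ge0.
- exact: measurable_nsq.
Qed.

(** On [A] both integrands vanish; off [A] the right one is [|f|^2] and the left one is either that
    or zero. *)
Lemma trunc_diff (A B : set T) (f : T -> R[i]) : measurable A -> measurable B ->
  cmeasurable f -> A `<=` B ->
  (nsq mu (fun x => trunc B f x - trunc A f x)%R <= nsq mu (fun x => trunc A f x - f x)%R)%E.
Proof.
move=> mA mB mf AB; apply: ge0_le_integral => //.
- by move=> x _; rewrite lee_fin sqr_ge0.
- by apply: measurable_nsq; apply: cmeasurableB; apply: cmeasurableM => //; exact: cmeasurable_indic.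
- by apply: measurable_nsq; apply: cmeasurableB => //; apply: cmeasurableM => //; exact: cmeasurable_indic.
move=> x _; rewrite lee_fin ler_pXn2r ?nnegrE ?normc_ge0// /trunc !indicE.
have [xA|xA] := boolP (x \in A).
  have -> : x \in B by rewrite inE; apply: AB; rewrite inE in xA.
  by rewrite subrr Normc.normc0 normc_ge0.
case: (x \in B) => /=; rewrite !mul0r ?sub0r ?subr0 ?mul1r ?normc_opp//.
by rewrite Normc.normc0 normc_ge0.
Qed.

Lemma trunc_cvg (A : nat -> set T) (f : T -> R[i]) :
  (forall n, measurable (A n)) -> (forall x, \forall n \near \oo, A n x) ->
  Lp mu 2%:E f -> nsq mu (fun x => trunc (A n) f x - f x) @[n --> \oo] --> 0%E.
Proof.
move=> mA Ax /Lp2P[mf fi].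
have mn n : cmeasurable (fun x => trunc (A n) f x - f x).
  by apply: cmeasurableB => //; apply: cmeasurableM => //; exact: cmeasurable_indic.
have := @dominated_convergence _ _ _ mu setT measurableT
  (fun n x => (normc (trunc (A n) f x - f x) ^+ 2)%:E) (cst 0%E)
  (fun x => (normc (f x) ^+ 2)%:E).
case=> //.
- by move=> n; exact: measurable_nsq.
- apply: aeW => x _; apply: cvg_near_cst.
  have := Ax x; apply: filterS => n Anx.
  by rewrite /trunc indicE mem_set// mul1r subrr Normc.normc0 expr0n.
- apply/integrableP; split; first exact: measurable_nsq.
  rewrite (eq_integral (fun x => (normc (f x) ^+ 2)%:E))// => x _.
  by rewrite gee0_abs// lee_fin sqr_ge0.
- apply: aeW => x n _; rewrite gee0_abs ?lee_fin ?sqr_ge0//.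
  rewrite ler_pXn2r ?nnegrE ?normc_ge0// /trunc indicE.
  case: (x \in A n) => /=.
    by rewrite mul1r subrr Normc.normc0 normc_ge0.
  by rewrite mul0r sub0r normc_opp.
by move=> _ _; rewrite integral_cst// mul0e.
Qed.

End truncation.

Section joint_transform.
Context {R : realType} {G : topologicalZmodType}.
Variables (muG : {measure set (borelG G) -> \bar R})
          (muD : {measure set (borel (dual R G)) -> \bar R}).
Hypothesis G_second_countable : @second_countable G.
Hypothesis muG_sigma_finite : sigma_finite [set: borelG G] muG.
Hypothesis muD_plancherel : plancherel_measure muG muD.

Lemma nsq_fourier (f : borelG G -> R[i]) : Lp muG 1%:E f /\ Lp muG 2%:E f ->
  nsq muD (fourier muG f : borel (dual R G) -> R[i]) = nsq muG f.
Proof.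
by move=> [f1 f2]; apply: cnorm2_eq; have [_ ->] := muD_plancherel.
Qed.

Lemma nsq_fourierB (f g : borelG G -> R[i]) :
  Lp muG 1%:E f /\ Lp muG 2%:E f -> Lp muG 1%:E g /\ Lp muG 2%:E g ->
  nsq muD (fun w : borel (dual R G) => fourier muG f w - fourier muG g w) =
  nsq muG (fun x => f x - g x).
Proof.
move=> Lf Lg; rewrite -nsq_fourier; last exact: LpB.
apply: eq_integral => w _; rewrite fourierB//; [exact: Lf.1|exact: Lg.1].
Qed.

Lemma Lp2_near {d : measure_display} {T : measurableType d}
    (mu : {measure set T -> \bar R}) (f g : T -> R[i]) :
  cmeasurable f -> Lp mu 2%:E g -> (nsq mu (fun x => f x - g x)%R < +oo)%E -> Lp mu 2%:E f.
Proof.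
move=> mf /Lp2P[mg gi] fg; apply/Lp2P; split => //.
rewrite (_ : f = (fun x => (f x - g x) + g x)); last by apply/funext => x; rewrite subrK.
apply: le_lt_trans (nsqD _ (cmeasurableB mf mg) mg) _.
by apply: lte_add_pinfty; rewrite lte_mul_pinfty.
Qed.

Lemma Lp_fourier (f : borelG G -> R[i]) : Lp muG 1%:E f /\ Lp muG 2%:E f ->
  Lp muD 2%:E (fourier muG f : borel (dual R G) -> R[i]).
Proof.
move=> Lf; apply/Lp2P; split.
  by apply: cmeasurable_fourier => //; exact: Lf.1.1.
by rewrite nsq_fourier//; have /Lp2P[] := Lf.2.
Qed.

(** Square integrability of [h] comes for free: [h] is at finite distance from the transform of some
    [v n]. *)
Lemma is_plancherel_transformP (f : borelG G -> R[i]) (h : borel (dual R G) -> R[i])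
    (v : nat -> borelG G -> R[i]) :
  cmeasurable h ->
  (forall n, Lp muG 1%:E (v n) /\ Lp muG 2%:E (v n)) ->
  nsq muG (fun x => v n x - f x) @[n --> \oo] --> 0%E ->
  nsq muD (fun w : borel (dual R G) => fourier muG (v n) w - h w) @[n --> \oo] --> 0%E ->
  is_plancherel_transform muG muD f h.
Proof.
move=> mh Lv vf vh; split; last by exists v; split => //; exact/cnorm2_cvg0.
have [n _ /(_ n (leqnn n)) vn] := nsq_cvg0_lt vh ltr01.
apply: (Lp2_near mh (Lp_fourier (Lv n))).
by rewrite nsqB; apply: lt_trans vn _; rewrite ltry.
Qed.

Lemma sigma_finite_exhaustion : exists F : nat -> set (borelG G),
  [/\ forall n, measurable (F n), forall n, (muG (F n) < +oo)%E,
      forall m n, (m <= n)%N -> F m `<=` F n & forall x, \forall n \near \oo, F n x].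
Proof.
have /sigma_finiteP[F [FT ndF mF]] := muG_sigma_finite.
have Fle m n : (m <= n)%N -> F m `<=` F n.
  by move=> /ndF; rewrite subsetEset.
exists F; split => //.
- by move=> n; exact: (mF n).1.
- by move=> n; exact: (mF n).2.
- move=> x; have : [set: borelG G] x by [].
  by rewrite FT => -[i _ Fix]; exists i => // n /= ni; exact: Fle Fix.
Qed.

(** Each [g p] is truncated at a level [N k p] with squared error at most [8^-1 ^+ k]. For fixed [p]
    the transforms of the truncations satisfy the hypotheses of [riesz_fischer], and [flim] yields a
    limit that is measurable in [p] and [w] together. *)
Lemma joint_transform_exists (d : measure_display) (P : measurableType d)
    (g : P -> borelG G -> R[i]) :
  (forall p, Lp muG 2%:E (g p)) ->
  cmeasurable (fun z : P * borelG G => g z.1 z.2) ->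
  exists h : P -> borel (dual R G) -> R[i],
    (forall p, is_plancherel_transform muG muD (g p) (h p)) /\
    cmeasurable (fun z : P * borel (dual R G) => h z.1 z.2).
Proof.
move=> g2 mg; have [F [mF Ffin Fnd Fall]] := sigma_finite_exhaustion.
pose tail n p := nsq muG (fun x => trunc (F n) (g p) x - g p x).
have mgn n : cmeasurable (fun z : P * borelG G => trunc (F n) (g z.1) z.2).
  apply: cmeasurableM => //.
  exact: (cmeasurable_comp (cmeasurable_indic (mF n)) measurable_snd).
have mtail n : measurable_fun setT (tail n).
  pose m' : {sigma_finite_measure set (borelG G) -> \bar R} := sigma_finite_of muG_sigma_finite.
  apply: (measurable_fun_fubini_tonelli_F (m2 := m') (fun z : P * borelG G =>
    (normc (trunc (F n) (g z.1) z.2 - g z.1 z.2) ^+ 2)%:E)) => //.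
    by apply: measurable_nsq; exact: cmeasurableB.
  by move=> z; rewrite lee_fin sqr_ge0.
have tail_cvg p k : exists n, (tail n p <= ((8^-1 ^+ k)%R)%:E)%E.
  have e0 : 0 < 8^-1 ^+ k :> R by rewrite exprn_gt0.
  have [n _ /(_ n (leqnn n)) h] := nsq_cvg0_lt (trunc_cvg mF Fall (g2 p)) e0.
  by exists n; exact: ltW.
(* Taking the least admissible level writes the level sets of [N k] through the measurable sets
   [S m] where the tail is small. *)
pose N k p := ex_minn (tail_cvg p k).
have N_tail k p : (tail (N k p) p <= ((8^-1 ^+ k)%R)%:E)%E.
  by rewrite /N; case: ex_minnP.
have mN k n : measurable [set p | N k p = n].
  pose S m := [set p | (tail m p <= ((8^-1 ^+ k)%R)%:E)%E].
  have mS m : measurable (S m).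
    by rewrite -[X in measurable X]setTI; exact: emeasurable_fun_infty_c.
  rewrite (_ : [set _ | _] = S n `\` \bigcup_(i in [set i | (i < n)%N]) S i).
    by apply: measurableD => //; exact: bigcup_measurable.
  apply/seteqP; split => [p <- |p [/= Sn nS]].
    split; first exact: N_tail.
    move=> [i /= iN Si]; move: iN; rewrite ltnNge /N; case: ex_minnP => m _ + /negP.
    by move=> /(_ i Si) ? ; apply.
  apply/eqP; rewrite eqn_leq /N; case: ex_minnP => m Sm mmin.
  rewrite mmin// leqNgt; apply/negP => mn; apply: nS; exists m => //.
pose v k p := trunc (F (N k p)) (g p).
have vL k p : Lp muG 1%:E (v k p) /\ Lp muG 2%:E (v k p) by exact: trunc_Lp.
pose V k (z : P * borel (dual R G)) := fourier muG (v k z.1) z.2.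
(* For a constant level [n] the transform [W n] is jointly measurable; [V k] is glued from these
   along the countable partition by [N k]. *)
have mV k : cmeasurable (V k).
  pose W n (z : P * borel (dual R G)) := fourier muG (trunc (F n) (g z.1)) z.2.
  apply: (cmeasurable_glue (N := fun z : P * borel (dual R G) => N k z.1) (f := W)).
    move=> n; rewrite (_ : [set _ | _] = fst @^-1` [set p | N k p = n])//.
    by rewrite -[X in measurable X]setTI; exact: measurable_fst.
  move=> n; exact: (cmeasurable_fourier_param G_second_countable muG_sigma_finite (mgn n)).
(* Whichever of the two truncation sets is the smaller, the tail it leaves bounds the difference,
   and both tails are at most [8^-1 ^+ m]. *)
have vcauchy p m n : (m <= n)%N ->
    (nsq muG (fun x => v n p x - v m p x)%R <= ((8^-1 ^+ m)%R)%:E)%E.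
  move=> mn; have mgp : cmeasurable (g p) := (g2 p).1.
  have le8 : (((8^-1 ^+ n)%R)%:E <= ((8^-1 ^+ m)%R)%:E :> \bar R)%E.
    by rewrite lee_fin; apply: ler_wiXn2l => //; rewrite invf_le1// ler1n.
  have [NN|/ltnW NN] := leqP (N m p) (N n p).
    by apply: le_trans (trunc_diff muG _ _ _ (Fnd _ _ NN)) (N_tail m p).
  rewrite nsqB; apply: le_trans le8.
  by apply: le_trans (trunc_diff muG _ _ _ (Fnd _ _ NN)) (N_tail n p).
exists (fun p => flim (fun k w => V k (p, w))); split; last exact: (cmeasurable_flim mV).
move=> p.
have mVp k : cmeasurable (fun w => V k (p, w)).
  by apply: (cmeasurable_comp (mV k)); exact: pair1_measurable.
have Vcauchy m n : (m <= n)%N ->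
    (nsq muD (fun w => V n (p, w) - V m (p, w))%R <= ((8^-1 ^+ m)%R)%:E)%E.
  move=> mn; have := vcauchy p _ _ mn.
  by rewrite -(nsq_fourierB (vL n p) (vL m p)).
apply: (is_plancherel_transformP (v := fun k => v k p)) => //.
- exact: cmeasurable_flim.
- by apply: nsq_geometric_cvg0 => k; exact: N_tail.
- apply: nsq_geometric_cvg0 => k; rewrite nsqB.
  exact: (riesz_fischer mVp Vcauchy).
Qed.

End joint_transform.

(** * Cutoff functions on the dual *)

Section threshold.
Context {R : realType}.
Implicit Types s t : R.

(** A cubic fixing 0, 1/2 and 1, attracting at 0 and 1 and repelling at 1/2. Being a polynomial, it
    preserves multipliers. *)
Definition smoothstep s : R := s ^+ 2 * (3 - 2 * s).

(** The value at 1/2 is the fixed point there, which makes this the limit of the iterates of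
    [smoothstep] on all of [0, 1]. *)
Definition threshold s : R := if s < 2^-1 then 0 else if s == 2^-1 then 2^-1 else 1.

Lemma smoothstep_itv s : 0 <= s <= 1 -> 0 <= smoothstep s <= 1.
Proof.
move=> /andP[s0 s1]; apply/andP; split.
  by apply: mulr_ge0; [exact: sqr_ge0|lra].
rewrite -subr_ge0 /smoothstep.
rewrite (_ : 1 - _ = (1 - s) ^+ 2 * (1 + 2 * s)); last by ring.
by apply: mulr_ge0; [exact: sqr_ge0|lra].
Qed.

Lemma smoothstep_compl s : smoothstep (1 - s) = 1 - smoothstep s.
Proof. by rewrite /smoothstep; ring. Qed.

Lemma iter_smoothstep_compl n s : iter n smoothstep (1 - s) = 1 - iter n smoothstep s.
Proof. by elim: n => //= n ->; rewrite smoothstep_compl. Qed.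

(** Between 0 and [s] the map [smoothstep] contracts towards 0 with ratio [l = s * (3 - 2 * s)],
    which is less than 1 because [s] is below 1/2. *)
Lemma iter_smoothstep_lt s : 0 <= s -> s < 2^-1 ->
  iter n smoothstep s @[n --> \oo] --> (0 : R).
Proof.
move=> s0 s2; pose l := s * (3 - 2 * s).
have l0 : 0 <= l by rewrite /l; nra.
have l1 : l < 1 by rewrite /l; nra.
have h n : 0 <= iter n smoothstep s <= s /\ iter n smoothstep s <= l ^+ n * s.
  elim: n => [|n [/andP[a0 as_] al]] /=.
    by rewrite s0 lexx expr0 mul1r.
  set t := iter n smoothstep s in a0 as_ al *.
  have tl : smoothstep t <= l * t.
    rewrite -subr_ge0 /smoothstep /l.
    rewrite (_ : _ - _ = t * ((s - t) * (3 - 2 * (s + t)))); last by ring.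
    by apply: mulr_ge0 => //; apply: mulr_ge0; lra.
  have t0 : 0 <= smoothstep t by apply: mulr_ge0; [exact: sqr_ge0|lra].
  split.
    rewrite t0 /=; apply: le_trans tl (le_trans _ as_).
    by rewrite ler_piMl// ltW.
  rewrite exprS -mulrA; apply: le_trans tl _.
  by rewrite ler_wpM2l.
have lim0 : (fun n => l ^+ n * s) @ \oo --> (0 : R).
  rewrite [X in _ --> X](_ : 0 = 0 * s); last by rewrite mul0r.
  apply: cvgM; last exact: cvg_cst.
  by apply: cvg_expr; rewrite ger0_norm.
apply: squeeze_cvgr (cvg_cst 0) lim0; apply: nearW => n.
by have [/andP[-> _] ->] := h n.
Qed.

Lemma iter_smoothstep_cvg s : 0 <= s <= 1 ->
  iter n smoothstep s @[n --> \oo] --> threshold s.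
Proof.
move=> /andP[s0 s1]; rewrite /threshold; case: ltP => [|s2].
  exact: iter_smoothstep_lt.
case: eqVneq => [->|ns].
  rewrite (_ : (fun n => _) = (fun=> 2^-1)); first exact: cvg_cst.
  apply/funext; elim => //= n ->; rewrite /smoothstep; by field.
(* Above 1/2 the symmetry about 1/2 reduces to the previous case. *)
have -> : (fun n => iter n smoothstep s) = (fun n => 1 - iter n smoothstep (1 - s)).
  by apply/funext => n; rewrite iter_smoothstep_compl opprB addrC subrK.
rewrite -[X in _ --> X]subr0; apply: cvgB; first exact: cvg_cst.
apply: iter_smoothstep_lt; first by rewrite subr_ge0.
have : 2^-1 < s by rewrite lt_neqAle eq_sym ns s2.
lra.
Qed.

End threshold.

(** * Approximable functions and their multipliers *)

Section approximable.
Context {R : realType} {G : topologicalZmodType}.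
Variables (muG : {measure set (borelG G) -> \bar R})
          (muD : {measure set (borel (dual R G)) -> \bar R}).
Hypothesis G_second_countable : @second_countable G.
Hypothesis muG_haar : @haar_measure R (pointed_group G) +%R muG.
Hypothesis muG_sigma_finite : sigma_finite [set: borelG G] muG.
Hypothesis muD_plancherel : plancherel_measure muG muD.

Local Notation dual := (dual R G).
Implicit Types (F H : borel dual -> R[i]) (psi : borel dual -> R).

Definition approximable F : Prop := Lp muD 2%:E F /\
  forall e : R, 0 < e -> exists2 v : borelG G -> R[i],
    Lp muG 1%:E v /\ Lp muG 2%:E v &
    (nsq muD (fun w : borel dual => (fourier muG v w - F w)%R) < e%:E)%E.

Lemma approximable_fourier (v : borelG G -> R[i]) :
  Lp muG 1%:E v /\ Lp muG 2%:E v -> approximable (fourier muG v).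
Proof.
move=> Lv; split; first exact: Lp_fourier.
move=> e e0; exists v => //; rewrite /nsq.
under eq_integral do rewrite subrr Normc.normc0 expr0n.
by rewrite integral0 lte_fin.
Qed.

Lemma approximable_lim F : cmeasurable F ->
  (forall e : R, 0 < e -> exists2 H, approximable H &
     (nsq muD (fun w => (H w - F w)%R) < e%:E)%E) -> approximable F.
Proof.
move=> mF h; split.
  have [H [H2 _] HF] := h _ ltr01.
  by apply: (Lp2_near mF H2); rewrite nsqB; apply: lt_trans HF _; rewrite ltry.
move=> e e0; have e4 : 0 < e / 4 by rewrite divr_gt0.
have [H [H2 Ha] HF] := h _ e4; have [v Lv vH] := Ha _ e4.
exists v => //; apply: (nsq_lt_double _ H2.1 mF vH HF).
exact: (Lp_fourier G_second_countable muG_sigma_finite muD_plancherel Lv).1.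
Qed.

Lemma approximableD F H : approximable F -> approximable H ->
  approximable (fun w => F w + H w).
Proof.
move=> [F2 Fa] [H2 Ha]; split; first exact: Lp2D.
move=> e e0; have e4 : 0 < e / 4 by rewrite divr_gt0.
have [v Lv vF] := Fa _ e4; have [u Lu uH] := Ha _ e4.
exists (fun x => v x + u x); first exact: LpD.
have mfv := (Lp_fourier G_second_countable muG_sigma_finite muD_plancherel Lv).1.
have mfu := (Lp_fourier G_second_countable muG_sigma_finite muD_plancherel Lu).1.
rewrite (_ : (fun w => _) = (fun w => (fourier muG v w - F w) + (fourier muG u w - H w))).
  apply: le_lt_trans (nsqD muD (cmeasurableB mfv F2.1) (cmeasurableB mfu H2.1)) _.
  rewrite (_ : e%:E = (2%:E * (e / 4)%:E + 2%:E * (e / 4)%:E)%E).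
    by apply: lteD; rewrite lte_pmul2l.
  by rewrite -!EFinM -EFinD; congr EFin; field.
apply/funext => w; rewrite fourierD; [|exact: Lv.1|exact: Lu.1].
by rewrite opprD addrACA.
Qed.

(** [op] is the operation on [G] that becomes multiplication by [c] after the Fourier transform; it
    enlarges the squared error at most by [M ^+ 2]. *)
Lemma approximable_bounded (c : borel dual -> R[i]) (M : R) F
    (op : (borelG G -> R[i]) -> (borelG G -> R[i])) :
  cmeasurable c -> (forall w, normc (c w) <= M) -> 
  (forall v, Lp muG 1%:E v /\ Lp muG 2%:E v ->
     (Lp muG 1%:E (op v) /\ Lp muG 2%:E (op v)) /\
     forall w, fourier muG (op v) w = c w * fourier muG v w) ->
  approximable F -> approximable (fun w => c w * F w).
Proof.
move=> mc cM opv [F2 Fa]; split; first exact: (Lp2_bounded mc cM F2).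
(* Adding 1 keeps the divisor positive when [M] is zero. *)
move=> e e0; pose M1 := M ^+ 2 + 1.
have M0 : 0 < M1 by rewrite /M1 ltr_wpDl ?sqr_ge0.
have [|v Lv vF] := Fa (e / M1); first by rewrite divr_gt0.
have [Lopv opvE] := opv _ Lv.
exists (op v) => //.
rewrite (_ : (fun w => _) = (fun w => c w * (fourier muG v w - F w))); last first.
  by apply/funext => w; rewrite opvE mulrBr.
have mfv := (Lp_fourier G_second_countable muG_sigma_finite muD_plancherel Lv).1.
have mvF := cmeasurableB mfv F2.1.
apply: le_lt_trans (nsq_bounded muD mc mvF cM) _.
apply: (@le_lt_trans _ _ (M1%:E * nsq muD (fun w : borel dual => (fourier muG v w - F w)%R))%E).
  by apply: lee_wpmul2r; [exact: nsq_ge0|rewrite lee_fin /M1 lerDl].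
have -> : e%:E = (M1%:E * (e / M1)%:E)%E.
  by rewrite -EFinM mulrCA divff ?mulr1// gt_eqF.
by rewrite lte_pmul2l.
Qed.

Lemma approximableZ (c : R[i]) F : approximable F -> approximable (fun w => c * F w).
Proof.
apply: (@approximable_bounded (fun=> c) (normc c) F (fun v x => c * v x)) => //.
move=> v Lv; split; first exact: LpZ.
by move=> w; rewrite fourierZ//; exact: Lv.1.
Qed.

Lemma approximable_eval (a : G) F : approximable F ->
  approximable (fun w => (w : dual) a * F w).
Proof.
apply: (@approximable_bounded (fun w => (w : dual) a) 1 F (fun v x => v (a + x))).
- exact: cmeasurable_eval.
- by move=> w; rewrite dual_norm.
move=> v Lv; split; first exact: Lp_shift.
by move=> w; rewrite fourier_shift//; exact: Lv.1.
Qed.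

(** Take [v k] with transforms at squared distance below [8^-1 ^+ k / 4] from [F]. The isometry
    makes [v] Cauchy in L2(G) at the rate required by [riesz_fischer], the divisor 4 absorbing the
    detour through [F], and the limit has transform [F]. *)
Lemma approximable_transform F : approximable F ->
  exists2 u, Lp muG 2%:E u & is_plancherel_transform muG muD u F.
Proof.
move=> [F2 Fa].
have h k : exists v, (Lp muG 1%:E v /\ Lp muG 2%:E v) /\
    (nsq muD (fun w : borel dual => (fourier muG v w - F w)%R) < (8^-1 ^+ k / 4)%:E)%E.
  by have [|v Lv vF] := Fa (8^-1 ^+ k / 4); [rewrite divr_gt0// exprn_gt0|exists v].
pose v k := sval (cid (h k)).
have Lv k : Lp muG 1%:E (v k) /\ Lp muG 2%:E (v k) := (svalP (cid (h k))).1.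
have vF k : (nsq muD (fun w : borel dual => (fourier muG (v k) w - F w)%R) < (8^-1 ^+ k / 4)%:E)%E
  := (svalP (cid (h k))).2.
have mfv k := (Lp_fourier G_second_countable muG_sigma_finite muD_plancherel (Lv k)).1.
have mv k : cmeasurable (v k) := (Lv k).1.1.
have vc m n : (m <= n)%N ->
    (nsq muG (fun x => v n x - v m x)%R <= ((8^-1 ^+ m)%R)%:E)%E.
  move=> mn; rewrite -(nsq_fourierB muD_plancherel (Lv n) (Lv m)); apply: ltW.
  apply: (nsq_lt_double (mfv n) F2.1 (mfv m)); last by rewrite nsqB.
  apply: lt_le_trans (vF n) _; rewrite lee_fin ler_wpM2r//.
  by apply: ler_wiXn2l => //; rewrite invf_le1// ler1n.
have rf := riesz_fischer mv vc.
have mu_ : cmeasurable (flim v) by exact: cmeasurable_flim.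
exists (flim v).
  by apply: (Lp2_near mu_ (Lv 0%N).2); apply: le_lt_trans (rf 0%N) _; rewrite ltry.
apply: (is_plancherel_transformP G_second_countable muG_sigma_finite muD_plancherel F2.1 Lv).
  by apply: nsq_geometric_cvg0 => k; rewrite nsqB.
apply: nsq_geometric_cvg0 => k; apply: le_trans (ltW (vF k)) _.
by rewrite lee_fin ler_pdivrMr// ler_peMr ?exprn_ge0// ler1n.
Qed.

(** Values in [0, 1] keep [smoothstep] and its iterates in range and provide the domination needed
    for pointwise limits. *)
Definition multiplier psi : Prop :=
  [/\ measurable_fun setT psi, forall w, 0 <= psi w <= 1 &
      forall F, approximable F -> approximable (fun w => (psi w)%:C%C * F w)].

(** The conjugate of [w a] is [w (- a)], so the real part is a combination of evaluations at [a] and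
    [- a], each preserving approximability; the affine rescaling brings it into [0, 1]. *)
Lemma multiplier_character (w0 : dual) (a : G) :
  multiplier (fun w => (1 + complex.Re ((w : dual) a * conjc (w0 a))) / 2).
Proof.
have mre : cmeasurable (fun w : borel dual => (w : dual) a * conjc (w0 a)).
  by apply: cmeasurableM; [exact: cmeasurable_eval|exact: cmeasurable_cst].
split.
- apply: measurable_funM => //; apply: measurable_funD => //; exact: mre.1.
- move=> w; have := ler_Re_normc ((w : dual) a * conjc (w0 a)).
  rewrite Normc.normcM normc_conjc !dual_norm mulr1 ler_norml => /andP[h1 h2].
  by apply/andP; split; lra.
move=> F Fa.
rewrite (_ : (fun w => _) = (fun w => 2^-1 * F w +
   ((conjc (w0 a) / 4) * ((w : dual) a * F w) + (w0 a / 4) * ((w : dual) (- a) * F w)))).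
  apply: approximableD; first exact: approximableZ.
  by apply: approximableD; apply: approximableZ; exact: approximable_eval.
apply/funext => w; rewrite dualN; case: ((w : dual) a) (w0 a) (F w) => [p q] [r s] [t u].
have e4 : (4^-1 : R[i]) = (4^-1)%:C%C by rewrite rmorphV ?unitfE// rmorph_nat.
have e2 : (2^-1 : R[i]) = (2^-1)%:C%C by rewrite rmorphV ?unitfE// rmorph_nat.
rewrite e4 e2; apply/eqP; rewrite eq_complex /=; apply/andP; split; apply/eqP; by field.
Qed.

Lemma multiplier_normc psi w : multiplier psi -> normc ((psi w)%:C%C : R[i]) <= 1.
Proof.
move=> [_ /(_ w)/andP[h0 h1] _].
by rewrite /= expr0n addr0 sqrtr_sqr ger0_norm.
Qed.

Lemma multiplierM psi1 psi2 : multiplier psi1 -> multiplier psi2 ->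
  multiplier (fun w => psi1 w * psi2 w).
Proof.
move=> [m1 b1 a1] [m2 b2 a2]; split.
- exact: measurable_funM.
- move=> w; have /andP[? ?] := b1 w; have /andP[? ?] := b2 w.
  by apply/andP; split; [exact: mulr_ge0|exact: mulr_ile1].
move=> F /a2/a1; congr approximable; apply/funext => w.
by rewrite rmorphM mulrA.
Qed.

Lemma multiplier1 : multiplier (fun=> 1).
Proof.
split => // [w|F]; first by rewrite ler01 lexx.
by congr approximable; apply/funext => w; rewrite mul1r.
Qed.

Lemma multiplierX psi m : multiplier psi -> multiplier (fun w => psi w ^+ m).
Proof.
move=> mpsi; elim: m => [|m IH]; first by under eq_fun do rewrite expr0; exact: multiplier1.
by under eq_fun do rewrite exprS; exact: multiplierM.
Qed.

Lemma multiplier_smoothstep psi : multiplier psi -> multiplier (fun w => smoothstep (psi w)).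
Proof.
move=> mpsi; have [m b a] := mpsi; have [m2 _ a2] := multiplierX 2 mpsi; split.
- apply: measurable_funM => //; apply: measurable_funB => //; exact: measurable_funM.
- by move=> w; exact: smoothstep_itv.
move=> F Fa.
rewrite (_ : (fun w => _) = (fun w => 3 * ((psi w ^+ 2)%:C%C * F w) +
    (- 2) * ((psi w)%:C%C * ((psi w ^+ 2)%:C%C * F w)))).
  by apply: approximableD; apply: approximableZ; [exact: a2|apply: a; exact: a2].
apply/funext => w; rewrite /smoothstep rmorphM rmorphB rmorphM !rmorph_nat.
by ring.
Qed.

(** Dominated convergence, with the integrable bound [|F|^2], turns pointwise convergence of the
    multipliers into L2 convergence of the products with [F]. *)
Lemma multiplier_lim (psi_ : nat -> borel dual -> R) psi :
  (forall n, multiplier (psi_ n)) ->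
  (forall w, psi_ n w @[n --> \oo] --> psi w) -> multiplier psi.
Proof.
move=> mpsi_ psi_psi.
have mpsi : measurable_fun setT psi.
  apply: (measurable_fun_cvg (h := psi_)).
    by move=> n; have [] := mpsi_ n.
  by move=> w _; exact: psi_psi.
have b w : 0 <= psi w <= 1.
  apply/andP; split.
    apply: (cvgr_to_ge (psi_psi w)); apply: nearW => n.
    by have [_ /(_ w)/andP[]] := mpsi_ n.
  apply: (cvgr_to_le (psi_psi w)); apply: nearW => n.
  by have [_ /(_ w)/andP[]] := mpsi_ n.
split => // F Fa; have [F2 _] := Fa; have /Lp2P[mF Ffin] := F2.
have mpsiF : cmeasurable (fun w => (psi w)%:C%C * F w).
  by apply: cmeasurableM => //; exact: cmeasurable_real.
have mpsiF_ n : cmeasurable (fun w => (psi_ n w)%:C%C * F w).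
  by apply: cmeasurableM => //; apply: cmeasurable_real; have [] := mpsi_ n.
apply: approximable_lim => // e e0.
have nE n w : normc ((psi_ n w)%:C%C * F w - (psi w)%:C%C * F w) =
    `|psi_ n w - psi w| * normc (F w).
  rewrite -mulrBl Normc.normcM -rmorphB; congr (_ * _).
  by rewrite /= expr0n addr0 sqrtr_sqr.
have cv : nsq muD (fun w => (psi_ n w)%:C%C * F w - (psi w)%:C%C * F w) @[n --> \oo] --> 0%E.
  have := @dominated_convergence _ _ _ muD setT measurableT
    (fun n w => (normc ((psi_ n w)%:C%C * F w - (psi w)%:C%C * F w) ^+ 2)%:E) (cst 0%E)
    (fun w => (normc (F w) ^+ 2)%:E).
  case=> //.
  - by move=> n; apply: measurable_nsq; exact: cmeasurableB.
  - apply: aeW => w _; apply: cvg_EFin; first exact: nearW.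
    have d0 : `|psi_ n w - psi w| * normc (F w) @[n --> \oo] --> (0 : R).
      rewrite [X in _ --> X](_ : 0 = `|psi w - psi w| * normc (F w)); last first.
        by rewrite subrr normr0 mul0r.
      apply: cvgM; last exact: cvg_cst.
      by apply: cvg_norm; apply: cvgB; [exact: psi_psi|exact: cvg_cst].
    have d00 : (`|psi_ n w - psi w| * normc (F w)) ^+ 2 @[n --> \oo] --> (0 : R).
      rewrite [X in _ --> X](_ : 0 = 0 * 0); last by rewrite mul0r.
      by under eq_fun do rewrite expr2; exact: cvgM.
    by under eq_fun do rewrite /= nE; exact: d00.
  - apply/integrableP; split; first exact: measurable_nsq.
    rewrite (eq_integral (fun w => (normc (F w) ^+ 2)%:E))// => w _.
    by rewrite gee0_abs// lee_fin sqr_ge0.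
  - apply: aeW => w n _; rewrite gee0_abs ?lee_fin ?sqr_ge0//.
    rewrite ler_pXn2r ?nnegrE ?normc_ge0// nE ler_piMl ?normc_ge0//.
    have [_ /(_ w)/andP[p0 p1] _] := mpsi_ n; have /andP[q0 q1] := b w.
    by rewrite ler_norml; apply/andP; split; lra.
  by move=> _ _; rewrite integral_cst// mul0e.
have [n _ /(_ n (leqnn n)) hn] := nsq_cvg0_lt cv e0.
exists (fun w => (psi_ n w)%:C%C * F w) => //.
by have [_ _ a] := mpsi_ n; exact: a.
Qed.

Lemma multiplier_threshold psi : multiplier psi -> multiplier (fun w => threshold (psi w)).
Proof.
move=> mpsi; apply: (multiplier_lim (psi_ := fun n w => iter n smoothstep (psi w))).
  by elim => //= n; exact: multiplier_smoothstep.
by move=> w; apply: iter_smoothstep_cvg; have [_ ->] := mpsi.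
Qed.

(** The partial products decrease and are nonnegative, hence converge, and a vanishing factor makes
    them eventually zero. *)
Lemma multiplier_prod (phi : nat -> borel dual -> R) : (forall i, multiplier (phi i)) ->
  exists psi, [/\ multiplier psi,
    forall w, (forall i, phi i w = 1) -> psi w = 1 &
    forall w i, phi i w = 0 -> psi w = 0].
Proof.
move=> mphi; pose P n (w : borel dual) : R := \prod_(i < n) phi i w.
have mP n : multiplier (P n).
  elim: n => [|n IH].
    by rewrite /P; under eq_fun do rewrite big_ord0; exact: multiplier1.
  by rewrite /P; under eq_fun do rewrite big_ord_recr /=; exact: multiplierM.
have P0 n w : 0 <= P n w by have [_ /(_ w)/andP[]] := mP n.
have cvgP w : cvgn (P ^~ w).
  apply: nonincreasing_is_cvgn.
    apply/nonincreasing_seqP => n; rewrite /P big_ord_recr/= ler_piMr//.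
      exact: P0.
    by have [_ /(_ w)/andP[]] := mphi n.
  by exists 0 => _ [n _ <-]; exact: P0.
exists (fun w => limn (P ^~ w)); split.
- exact: (multiplier_lim mP).
- move=> w h; apply: cvg_lim => //.
  rewrite (_ : P ^~ w = fun=> 1); first exact: cvg_cst.
  by apply/funext => n; rewrite /P big1.
- move=> w i h; apply: cvg_lim => //; apply: cvg_near_cst.
  exists i.+1 => // n /= ni; rewrite /P.
  by apply/eqP; rewrite prodf_seq_eq0; apply/hasP; exists (Ordinal ni); rewrite ?mem_index_enum//= h.
Qed.

End approximable.

(** * Compactly supported transforms bounded below near a point *)

Section local_transform.
Context {R : realType} {G : topologicalZmodType}.
Variables (muG : {measure set (borelG G) -> \bar R})
          (muD : {measure set (borel (dual R G)) -> \bar R}).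
Hypothesis G_hausdorff : hausdorff_space G.
Hypothesis G_second_countable : @second_countable G.
Hypothesis muG_haar : @haar_measure R (pointed_group G) +%R muG.
Hypothesis muG_sigma_finite : sigma_finite [set: borelG G] muG.
Hypothesis muD_plancherel : plancherel_measure muG muD.
Local Notation dual := (dual R G).

Lemma normcB_unit (a b : R[i]) : normc a = 1 -> normc b = 1 ->
  normc (a - b) ^+ 2 = 2 - 2 * complex.Re (a * conjc b).
Proof.
move=> a1 b1; have : normc a ^+ 2 + normc b ^+ 2 = 2 by rewrite a1 b1 expr1n.
rewrite !normc_sqr; case: a b {a1 b1} => [p q] [r s] /= h.
by rewrite -[X in _ = X - _]h; ring.
Qed.

Lemma bernoulli_ge (t : R) (m : nat) : 0 <= t <= 1 -> 1 - m%:R * t <= (1 - t) ^+ m.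
Proof.
move=> /andP[t0 t1]; elim: m => [|m IH]; first by rewrite mul0r subr0 expr0.
rewrite exprS; apply: (@le_trans _ _ ((1 - t) * (1 - m%:R * t))).
  rewrite -natr1 -subr_ge0.
  rewrite (_ : _ - _ = m%:R * t ^+ 2); last by ring.
  by rewrite mulr_ge0// sqr_ge0.
by rewrite ler_wpM2l// subr_ge0.
Qed.

(** One minus a quarter of the squared distance from [w x] to [w0 x], written in the form of
    [multiplier_character]. *)
Definition proximity (w0 : dual) (x : G) (w : dual) : R :=
  (1 + complex.Re (w x * conjc (w0 x))) / 2.

Lemma proximityE w0 x w : proximity w0 x w = 1 - normc (w x - w0 x) ^+ 2 / 4.
Proof. by rewrite /proximity normcB_unit ?dual_norm//; field. Qed.

Lemma proximity_continuous w0 x : continuous (proximity w0 x).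
Proof.
have -> : proximity w0 x = (fun w : dual => (1 + (complex.Re (w x) * complex.Re (w0 x) +
    complex.Im (w x) * complex.Im (w0 x))) / 2).
  apply/funext => w; rewrite /proximity; case: (w x) (w0 x) => [a b] [c d] /=; ring.
move=> w; have FF : Filter (nbhs w) by exact: nbhs_filter.
apply: cvgM; last exact: cvg_cst.
apply: cvgD; first exact: cvg_cst.
by apply: cvgD; (apply: cvgM; last exact: cvg_cst);
  [exact: dual_Re_continuous|exact: dual_Im_continuous].
Qed.

Lemma proximity_continuous2 w0 w : continuous (proximity w0 ^~ w).
Proof.
have -> : proximity w0 ^~ w = (fun x : G => (1 + (complex.Re (w x) * complex.Re (w0 x) +
    complex.Im (w x) * complex.Im (w0 x))) / 2).
  apply/funext => x; rewrite /proximity; case: (w x) (w0 x) => [a b] [c d] /=; ring.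
move=> x; have FF : Filter (nbhs x) by exact: nbhs_filter.
apply: cvgM; last exact: cvg_cst.
apply: cvgD; first exact: cvg_cst.
by apply: cvgD; apply: cvgM;
  [exact: dual_Re_continuous2|exact: dual_Re_continuous2|
   exact: dual_Im_continuous2|exact: dual_Im_continuous2].
Qed.

Lemma proximity_itv w0 x w : 0 <= proximity w0 x w <= 1.
Proof.
have [_ h _] := multiplier_character G_second_countable muG_haar muG_sigma_finite
  muD_plancherel w0 x.
exact: h.
Qed.

(** The cutoff is a product of thresholds of a high power of the proximity, one for each point of a
    dense sequence in a compact [C]. It can be nonzero only if [w] is uniformly close to [w0] on
    [C], which confines [w] to [U] and to a compact neighbourhood. *)
Lemma dual_cutoff (w0 : dual) (U : set dual) : nbhs w0 U ->
  exists psi, multiplier muG muD psi /\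
  exists V O : set dual, [/\ compact V, V `<=` U, forall w, ~ V w -> psi w = 0,
    nbhs w0 O & forall w, O w -> psi w = 1].
Proof.
move=> w0U; have [haarD _] := muD_plancherel.
have [N cN w0N] := dual_compact_nbhs haarD w0.
have /nbhs_dualP[C [e [cC e0] CUN]] : nbhs w0 (U `&` N) by exact: filterI.
have [m pm] : exists m, forall x w, 2^-1 <= proximity w0 x w ^+ m ->
    normc (w x - w0 x) < e.
  (* [r] is the largest proximity possible at distance at least [e]. If it is negative no such
     distance occurs and the exponent 0 will do; otherwise [r ^+ m] falls below 1/2. *)
  pose r := 1 - e ^+ 2 / 4.
  have [r0|r0] := ltP r 0.
    exists 0%N => x w _; have /andP[p0 _] := proximity_itv w0 x w.
    rewrite ltNge; apply/negP => h.
    have : e ^+ 2 <= normc (w x - w0 x) ^+ 2 by rewrite ler_pXn2r ?nnegrE ?normc_ge0// ltW.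
    by rewrite proximityE in p0; rewrite /r in r0; lra.
  have r1 : r < 1 by rewrite /r ltrBlDr ltrDl divr_gt0// exprn_gt0.
  have : (fun m => r ^+ m) @ \oo --> (0 : R) by apply: cvg_expr; rewrite ger0_norm.
  have h2 : 0 < 2^-1 :> R by rewrite invr_gt0.
  move=> /cvgrPdist_lt/(_ _ h2)[m _ /(_ m (leqnn m)) rm].
  rewrite sub0r normrN ger0_norm ?exprn_ge0// in rm.
  exists m => x w hw; rewrite ltNge; apply/negP => h.
  have h3 : e ^+ 2 <= normc (w x - w0 x) ^+ 2 by rewrite ler_pXn2r ?nnegrE ?normc_ge0// ltW.
  have pr : proximity w0 x w <= r by rewrite proximityE /r; lra.
  have : proximity w0 x w ^+ m <= r ^+ m.
    by apply: lerXn2r; rewrite ?nnegrE//; have /andP[] := proximity_itv w0 x w.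
  lra.
have [b [bo bn]] := second_countable_seq G_second_countable.
(* One point of [C] from each basic open set meeting it. The default 0 is harmless, because all
   characters agree there and its factor is 1. *)
pose a n : G := xget 0 (b n `&` C).
have aC n : C (a n) \/ a n = 0.
  by rewrite /a; case: xgetP => [y _ [_ Cy]|_]; [left|right].
pose phi n (w : borel dual) := threshold (proximity w0 (a n) w ^+ m).
have mphi n : multiplier muG muD (phi n).
  apply: multiplier_threshold => //; apply: multiplierX => //.
  exact: multiplier_character.
have [psi [mpsi psi1 psi0]] := multiplier_prod G_second_countable muG_sigma_finite muD_plancherel mphi.
exists psi; split => //.
pose V : set dual := [set w | forall x, C x -> 2^-1 <= proximity w0 x w ^+ m].
have VUN : V `<=` U `&` N.
  by move=> w Vw; apply: CUN => x Cx; exact/pm/Vw.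
(* Within [delta] of [w0] the proximity is at least [1 - delta / 4], so by Bernoulli's inequality
   its power [m] is at least 3/4, above the threshold. *)
pose delta : R := m.+1%:R^-1.
have delta0 : 0 < delta by rewrite invr_gt0.
exists V, [set w : dual | forall x, C x -> normc (w x - w0 x) < delta]; split.
- apply: (subclosed_compact _ cN); last by move=> w /VUN[].
  rewrite (_ : V = \bigcap_(x in C) [set w | 2^-1 <= proximity w0 x w ^+ m])//.
  apply: closed_bigI => x _.
  rewrite (_ : [set w | _] = (fun w => proximity w0 x w ^+ m) @^-1` [set r | 2^-1 <= r])//.
  apply: closed_comp; last exact: closed_ge.
  move=> w _; apply: (@continuous_comp _ _ _ (proximity w0 x) (fun r => r ^+ m)).
    exact: proximity_continuous.
  exact: exprn_continuous.
- by move=> w /VUN[].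
(* A proximity power below 1/2 at a point of [C] stays below 1/2 on a basic neighbourhood, hence at
   some [a n], whose factor then vanishes. *)
- move=> w /existsNP[x /not_implyP[Cx /negP]]; rewrite -ltNge => px.
  have : nbhs x [set y | proximity w0 y w ^+ m < 2^-1].
    have cont : {for x, continuous (fun y => proximity w0 y w ^+ m)}.
      apply: (@continuous_comp _ _ _ (proximity w0 ^~ w) (fun r => r ^+ m)).
        exact: proximity_continuous2.
      exact: exprn_continuous.
    exact: (cont _ (open_nbhs_nbhs (conj (@open_lt _ (2^-1)) px))).
  move=> /bn[n [bx bU]]; apply: (psi0 _ n); rewrite /phi /threshold ifT//.
  apply: bU; rewrite /a; case: xgetP => [y _ []//|/(_ x)].
  by case.
- exact: nbhs_dual.
- move=> w Ow; apply: psi1 => n; rewrite /phi.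
  suff p : 2^-1 < proximity w0 (a n) w ^+ m by rewrite /threshold ltNge (ltW p)/= gt_eqF.
  have [/Ow h|->] := aC n; last first.
    by rewrite proximityE !dual0 subrr Normc.normc0 expr0n mul0r subr0 expr1n invf_lt1// ltr1n.
  rewrite proximityE; set t := _ / 4.
  have d1 : delta <= 1 by rewrite invf_le1// ler1n.
  have hd : normc (w (a n) - w0 (a n)) ^+ 2 <= delta ^+ 2.
    by rewrite ler_pXn2r ?nnegrE ?normc_ge0 ?ltW.
  have t0 : 0 <= t by rewrite divr_ge0// sqr_ge0.
  have td : t <= delta / 4.
    rewrite ler_pM2r ?invr_gt0//; apply: le_trans hd _.
    by rewrite expr2 ler_piMl// ltW.
  have md : m%:R * delta <= 1.
    by rewrite /delta ler_pdivrMr// mul1r ler_nat.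
  have t1 : 0 <= t <= 1 by rewrite t0; lra.
  apply: lt_le_trans (bernoulli_ge m t1).
  have : m%:R * t <= m%:R * (delta / 4) by rewrite ler_wpM2l.
  rewrite mulrA; lra.
Qed.

Lemma trunc_dual_Lp (w0 : dual) (K : set (borelG G)) : measurable K -> (muG K < +oo)%E ->
  Lp muG 1%:E (trunc K w0) /\ Lp muG 2%:E (trunc K w0).
Proof.
move=> mK Kfin.
have nE x : normc (trunc K w0 x) = \1_K x.
  rewrite /trunc Normc.normcM dual_norm mulr1 /= expr0n addr0 sqrtr_sqr ger0_norm//.
have mt : cmeasurable (trunc K w0).
  by apply: cmeasurableM; [exact: cmeasurable_indic|exact: cmeasurable_dual].
split; [apply/Lp1P|apply/Lp2P]; split => //.
  by under eq_integral do rewrite nE; rewrite integral_indic// setIT.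
rewrite /nsq; under eq_integral do rewrite nE.
rewrite (eq_integral (fun x => (\1_K x)%:E)); first by rewrite integral_indic// setIT.
by move=> x _; rewrite indicE; case: (_ \in _); rewrite ?expr1n ?expr0n.
Qed.

(** On [K] the real part of [w0 x * conjc (w x)] equals one minus half the squared distance, hence
    exceeds 1/2; integrate over [K]. *)
Lemma fourier_trunc_lower (w0 w : dual) (K : set (borelG G)) :
  measurable K -> (muG K < +oo)%E ->
  (forall x, K x -> normc (w x - w0 x) < 1) ->
  fine (muG K) / 2 <= normc (fourier muG (trunc K w0) w).
Proof.
move=> mK Kfin close; have [L1 _] := trunc_dual_Lp w0 mK Kfin.
have [ir _] := Lp1_integrable (Lp1_fourier_integrand w L1).
apply: le_trans (le_trans (ler_norm _) (ler_Re_normc _)) => /=.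
have i1 : muG.-integrable setT (fun x => (\1_K x)%:E).
  apply/integrableP; split; first by apply/measurable_EFinP; exact: measurable_indic.
  rewrite (eq_integral (fun x => (\1_K x)%:E)); first by rewrite integral_indic// setIT.
  by move=> x _; rewrite gee0_abs// lee_fin.
have iK : muG.-integrable setT (EFin \o (fun x => \1_K x / 2)).
  rewrite (_ : _ \o _ = (fun x => (2^-1)%:E * (\1_K x)%:E)%E); last first.
    by apply/funext => x; rewrite /= mulrC EFinM.
  exact: integrableZl.
have -> : fine (muG K) / 2 = (\int[muG]_x (\1_K x / 2))%R.
  under eq_Rintegral do rewrite mulrC.
  rewrite RintegralZl//.
  by rewrite mulrC /Rintegral integral_indic// setIT.
apply: le_Rintegral => // x _; rewrite /trunc indicE.
have [xK|xK] := boolP (x \in K); last by rewrite !mul0r.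
rewrite (_ : true%:R = 1 :> R)// mul1r.
have := normcB_unit (dual_norm w0 x) (dual_norm w x).
have : normc (w0 x - w x) ^+ 2 < 1.
  by rewrite expr_lt1 ?normc_ge0// normcB close//; rewrite inE in xK.
rewrite (_ : 1%:C%C * w0 x = w0 x); last by rewrite mul1r.
move=> h1 h2; lra.
Qed.

Lemma haar_compact_gt0 : exists2 K : set G, compact K & (0 < muG K)%E.
Proof.
have [[_ _ inner] /negP T0 _] := muG_haar.
apply: contrapT => h; apply: T0; rewrite eq_le measure_ge0 andbT.
rewrite (inner _ openT); apply: ge_ereal_sup => _ [K [cK _] <-].
by rewrite leNgt; apply/negP => K0; apply: h; exists K.
Qed.

(** [F] is the cutoff times the transform of [w0] truncated to a compact [K] of positive measure. On
    [O] the cutoff is 1 and [w] is within 1 of [w0] on [K], whence the lower bound. *)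
Lemma local_transform (w0 : dual) (U : set dual) : nbhs w0 U ->
  exists (u : borelG G -> R[i]) (F : borel dual -> R[i]) (V O : set dual) (c M : R),
  [/\ Lp muG 2%:E u, is_plancherel_transform muG muD u F & forall w, normc (F w) <= M] /\
  [/\ compact V, V `<=` U & forall w, ~ V w -> F w = 0] /\
  [/\ nbhs w0 O, 0 < c & forall w, O w -> c <= normc (F w)].
Proof.
move=> w0U; have [psi [mpsi [V [W [cV VU psi0 w0W psi1]]]]] := dual_cutoff w0U.
have [K cK K0] := haar_compact_gt0.
have mK : measurable (K : set (borelG G)).
  by apply: borel_compact.
have Kfin : (muG K < +oo)%E by have [[fin _ _] _ _] := muG_haar; exact: fin.
have Lf := trunc_dual_Lp w0 mK Kfin.
pose f := trunc (K : set (borelG G)) w0.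
have [_ psib mpsia] := mpsi.
have ap := mpsia _ (approximable_fourier G_second_countable muG_sigma_finite muD_plancherel Lf).
have [u u2 uF] := approximable_transform G_second_countable muG_sigma_finite muD_plancherel ap.
exists u, (fun w => (psi w)%:C%C * fourier muG f w), V,
  (W `&` [set w : dual | forall x, K x -> normc (w x - w0 x) < 1]), (fine (muG K) / 2),
  (2 * fine (\int[muG]_x (normc (f x))%:E)%E).
split; [split => //|split; [split => //|split]].
- move=> w; rewrite Normc.normcM; apply: le_trans (normc_fourier_le w Lf.1).
  by rewrite ler_piMl ?normc_ge0//; exact: multiplier_normc mpsi.
- by move=> w /psi0 ->; rewrite mul0r.
- by apply: filterI => //; exact: nbhs_dual.
- by rewrite divr_gt0// fine_gt0// K0.
- move=> w [Ww Kw]; rewrite psi1// mul1r; exact: fourier_trunc_lower.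
Qed.

End local_transform.

(** * The Calderon sum *)

Section nonneg_integrals.
Context {R : realType}.

(* Unlike [ge0_le_integral], no measurability is required: the integral of a
   nonnegative function is a supremum over the simple functions below it. *)
Lemma ge0_le_integral_nonmeas {d : measure_display} {T : measurableType d}
    (mu : {measure set T -> \bar R}) (f g : T -> \bar R) :
  (forall x, (0 <= f x)%E) -> (forall x, (f x <= g x)%E) ->
  (\int[mu]_x f x <= \int[mu]_x g x)%E.
Proof.
move=> f0 fg; have g0 x : (0 <= g x)%E by exact: le_trans (fg x).
rewrite !ge0_integralTE//; apply: le_ereal_sup => _ [h /= hf <-].
by exists h => // x; exact: le_trans (fg x).
Qed.

(** Turns an unordered sum into a series along the coding of [J], with zero at numbers that code
    nothing, so that integrals can be exchanged with it. *)
Lemma esum_countType {J : countType} (a : J -> \bar R) : (forall j, (0 <= a j)%E) ->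
  (\esum_(j in [set: J]) a j = \sum_(n <oo) (oapp a 0 (@pickle_inv J n)))%E.
Proof.
move=> a0; rewrite nneseries_esumT; last by move=> n; case: (@pickle_inv J n) => /=.
pose Q := [set n : nat | isSome (@pickle_inv J n)].
transitivity (\esum_(n in Q) oapp a 0%E (@pickle_inv J n))%E; last first.
  rewrite esum_mkcond; apply: eq_esum => n _; case: ifPn => //.
  by rewrite notin_setE /Q /=; case: (@pickle_inv J n).
rewrite (@reindex_esum _ _ _ [set: J] Q pickle).
  by apply: eq_esum => j _; rewrite pickleK_inv.
split.
- by move=> j _; rewrite /Q /= pickleK_inv.
- by move=> i j _ _; exact: (pcan_inj pickleK_inv).
- move=> n; rewrite /Q /=; have := @pickle_invK J n.
  by case: (@pickle_inv J n) => //= j <- _; exists j.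
Qed.

Section restricted_tonelli.
Context {d d' : measure_display} {X : measurableType d} {Y : measurableType d'}.
Variables (m : {sigma_finite_measure set X -> \bar R}) (mu : {measure set Y -> \bar R}).
Variables (B : set Y) (mB : measurable B) (Bfin : (mu B < +oo)%E).
Variable f : X * Y -> \bar R.
Hypothesis mf : measurable_fun setT f.
Hypothesis f0 : forall z, (0 <= f z)%E.

(** The restriction of [mu] to [B] is finite, so Tonelli's theorem applies to it even when [mu]
    itself is not sigma-finite. *)
Let muB : {measure set Y -> \bar R} := mrestr mu mB.

Let muB_sigma_finite : sigma_finite setT muB.
Proof.
apply: fin_num_fun_sigma_finite; first by rewrite measure0 ltry.
move=> A mA; rewrite /muB /= /mrestr ge0_fin_numE ?measure_ge0//.
by apply: le_lt_trans Bfin; apply: le_measure; rewrite ?inE//; exact: measurableI.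
Qed.

Let m2 : {sigma_finite_measure set Y -> \bar R} := sigma_finite_of muB_sigma_finite.

Let g (z : X * Y) : \bar R := (f z * (\1_B z.2)%:E)%E.

Let mg : measurable_fun setT g.
Proof.
apply: emeasurable_funM => //; apply/measurable_EFinP.
exact: (measurableT_comp (measurable_indic mB) measurable_snd).
Qed.

Let g0 z : (0 <= g z)%E.
Proof. by rewrite mule_ge0// lee_fin. Qed.

Let restr_integral (h : Y -> \bar R) :
  (\int[m2]_y (h y * (\1_B y)%:E) = \int[mu]_(y in B) h y)%E.
Proof.
transitivity (\int[m2]_(y in B) h y)%E.
  rewrite [RHS]integral_mkcond; apply: eq_integral => y _.
  by rewrite patchE indicE; case: (y \in B); rewrite ?mule1 ?mule0.
apply: eq_measure_integral => A mA AB.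
by rewrite /m2 /= /sigma_finite_of /muB /= /mrestr setIidl.
Qed.

Lemma measurable_restricted_integral :
  measurable_fun setT (fun x => (\int[mu]_(y in B) f (x, y))%E).
Proof.
have := measurable_fun_fubini_tonelli_F (m2 := m2) g mg g0.
by congr measurable_fun; apply/funext => x; exact: (restr_integral (fun y => f (x, y))).
Qed.

Lemma restricted_tonelli :
  (\int[m]_x \int[mu]_(y in B) f (x, y) = \int[mu]_(y in B) \int[m]_x f (x, y))%E.
Proof.
transitivity (\int[m]_x \int[m2]_y g (x, y))%E.
  by apply: eq_integral => x _; rewrite (restr_integral (fun y => f (x, y))).
rewrite -restr_integral.
rewrite (fubini_tonelli (m1 := m) (m2 := m2) g)//.
apply: eq_integral => y _; rewrite /g /= indicE; case: (y \in B).
  by rewrite mule1; apply: eq_integral => x _; rewrite mule1.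
by rewrite mule0; under eq_integral do rewrite mule0; rewrite integral0.
Qed.

End restricted_tonelli.

End nonneg_integrals.

(** * Uniqueness of the Plancherel transform almost everywhere *)

Section plancherel_representative.
Context {R : realType} {G : topologicalZmodType}.
Variables (muG : {measure set (borelG G) -> \bar R})
          (muD : {measure set (borel (dual R G)) -> \bar R}).
Hypothesis G_second_countable : @second_countable G.
Hypothesis muG_sigma_finite : sigma_finite [set: borelG G] muG.
Hypothesis muD_plancherel : plancherel_measure muG muD.

Lemma nsq_eq0_ae {d : measure_display} {T : measurableType d}
    (mu : {measure set T -> \bar R}) (f g : T -> R[i]) :
  cmeasurable f -> cmeasurable g -> nsq mu (fun x => f x - g x) = 0%E ->
  {ae mu, forall x, f x = g x}.
Proof.
move=> mf mg fg.
have [h _] := ae_eq_integral_abs mu measurableT (measurable_nsq (cmeasurableB mf mg)).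
have : ae_eq mu setT (fun x => (normc (f x - g x) ^+ 2)%:E) (cst 0%E).
  apply: h; rewrite -[RHS]fg; apply: eq_integral => x _.
  by rewrite gee0_abs// lee_fin sqr_ge0.
apply: filterS => x /(_ I) /= [] /eqP.
by rewrite sqrf_eq0 => /eqP/Normc.eq0_normc/eqP; rewrite subr_eq0 => /eqP.
Qed.

(** The approximating sequences [u] and [v] both tend to [f], so by the isometry their transforms
    become close, and these tend to [h] and [k]. *)
Lemma plancherel_transform_unique (f : borelG G -> R[i]) (h k : borel (dual R G) -> R[i]) :
  Lp muG 2%:E f -> is_plancherel_transform muG muD f h ->
  is_plancherel_transform muG muD f k -> {ae muD, forall w, h w = k w}.
Proof.
move=> f2 [h2 [u [Lu /cnorm2_cvg0 uf /cnorm2_cvg0 uh]]] [k2 [v [Lv /cnorm2_cvg0 vf /cnorm2_cvg0 vk]]].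
apply: (nsq_eq0_ae h2.1 k2.1); apply/eqP; rewrite eq_le nsq_ge0 andbT.
apply/lee_addgt0Pr => e e0; rewrite add0e.
(* Each passage through an intermediate function divides the tolerance by 4; there are three,
   through the two transforms and through [f]. *)
have e4 : 0 < e / 4 by rewrite divr_gt0.
have e16 : 0 < e / 4 / 4 by rewrite divr_gt0.
have e64 : 0 < e / 4 / 4 / 4 by rewrite divr_gt0.
near \oo => n.
have mu_ := (Lp_fourier G_second_countable muG_sigma_finite muD_plancherel (Lu n)).1.
have mv_ := (Lp_fourier G_second_countable muG_sigma_finite muD_plancherel (Lv n)).1.
apply: ltW; apply: (nsq_lt_double h2.1 mu_ k2.1).
  by rewrite nsqB; near: n; exact: (nsq_cvg0_lt uh e4).
apply: (nsq_lt_double mu_ mv_ k2.1); last by near: n; exact: (nsq_cvg0_lt vk e16).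
rewrite (nsq_fourierB muD_plancherel (Lu n) (Lv n)).
apply: (nsq_lt_double (Lu n).1.1 f2.1 (Lv n).1.1).
  by near: n; exact: (nsq_cvg0_lt uf e64).
by rewrite nsqB; near: n; exact: (nsq_cvg0_lt vf e64).
Unshelve. all: by end_near.
Qed.

(** The existence of [h] rules out the default of [xget], so [plancherel] is a genuine transform, to
    which uniqueness applies. *)
Lemma plancherelP (f : borelG G -> R[i]) (h : borel (dual R G) -> R[i]) :
  Lp muG 2%:E f -> is_plancherel_transform muG muD f h ->
  Lp muD 2%:E (plancherel muG muD f : borel (dual R G) -> R[i]) /\
  {ae muD, forall w, plancherel muG muD f w = h w}.
Proof.
move=> f2 fh.
have fp : is_plancherel_transform muG muD f (plancherel muG muD f).
  by rewrite /plancherel; case: xgetP => [g _ //|/(_ h)].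
by split; [exact: fp.1|exact: plancherel_transform_unique f2 fp fh].
Qed.

End plancherel_representative.

(** * Essential supports *)

Section essential_support.
Context {R : realType} {G : topologicalZmodType}.
Variable muD : {measure set (borel (dual R G)) -> \bar R}.
Local Notation dual := (dual R G).
Implicit Types (f F : borel dual -> R[i]).

Lemma ess_support_closed f : closed (ess_support muD f).
Proof.
rewrite -[ess_support _ _]setCK; apply: open_closedC; rewrite openE => w.
move=> /existsNP[U /not_implyP[wU /contrapT nU]].
have wU' := nbhs_interior wU.
apply: filterS wU' => v vU vS; apply: (vS U) => //.
Qed.

Lemma ess_support_sub f F (V : set dual) : closed V ->
  {ae muD, forall w, f w = F w} -> (forall w, ~ V w -> F w = 0) ->
  ess_support muD f `<=` V.
Proof.
move=> cV fF F0 w ws; apply: contrapT => nVw; apply: (ws (~` V)).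
  by apply: open_nbhs_nbhs; split => //; exact: closed_openC.
apply: negligibleS fF => v [/= nVv /eqP fv] fFv; apply: fv.
by rewrite fFv F0.
Qed.

(** A neighbourhood of a point of [O] on which [f] vanished almost everywhere would meet [O] in a
    set containing a nonempty null open set, against positivity of Haar measure. *)
Lemma ess_support_open f F (O : set dual) :
  haar_measure (@dual_mul R G) muD -> open O ->
  {ae muD, forall w, f w = F w} -> (forall w, O w -> F w != 0) ->
  O `<=` ess_support muD f.
Proof.
move=> haarD oO fF F0 w Ow U wU neg.
have oW : open (U^° `&` O) by apply: openI => //; exact: open_interior.
have W0 : muD (U^° `&` O) = 0%E.
  apply/negligibleP; first exact: borel_open.
  apply: negligibleS (negligibleU neg fF) => v [vU Ov].
  have [fv|fv] := eqVneq (f v) 0.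
    by right => /= fFv; have := F0 v Ov; rewrite -fFv fv eqxx.
  by left; split => //; exact: interior_subset.
have : (0 < muD (U^° `&` O))%E.
  by apply: dual_open_measure_gt0 => //; exists w; split => //; exact: nbhs_singleton (nbhs_interior wU).
by rewrite W0 ltxx.
Qed.

End essential_support.

(** * Local integrability of the Calderon sum *)

Section calderon.
Context {R : realType} {G : topologicalZmodType}.
Variables (muG : {measure set (borelG G) -> \bar R})
          (muD : {measure set (borel (dual R G)) -> \bar R}).
Hypothesis G_hausdorff : hausdorff_space G.
Hypothesis G_second_countable : @second_countable G.
Hypothesis muG_haar : @haar_measure R (pointed_group G) +%R muG.
Hypothesis muG_sigma_finite : sigma_finite [set: borelG G] muG.
Hypothesis muD_plancherel : plancherel_measure muG muD.
Context {J : countType}.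
Variable sys : J -> gti_layer muG.
Local Notation dual := (dual R G).
Local Notation hat := (plancherel muG muD).

Lemma covolumeV_ge0 (L : gti_layer muG) : (0 <= (covolume L)^-1)%E.
Proof. by rewrite inve_ge0; exact: measure_ge0. Qed.

Variable h : forall j, gti_index (sys j) -> borel dual -> R[i].
Hypothesis hP : jointly_measurable_transforms muD h.

Let density j (w : borel dual) : \bar R :=
  (\int[gti_index_measure (sys j)]_p (normc (h p w) ^+ 2)%:E)%E.

Let density_ge0 j w : (0 <= density j w)%E.
Proof. by apply: integral_ge0 => p _; rewrite lee_fin sqr_ge0. Qed.

Let measurable_density j : measurable_fun setT (density j).
Proof.
apply: (measurable_fun_fubini_tonelli_G (m1 := gti_index_measure (sys j))
  (fun z : gti_index (sys j) * borel dual => (normc (h z.1 z.2) ^+ 2)%:E)).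
  by apply: measurable_nsq; have [] := hP j.
by move=> z; rewrite lee_fin sqr_ge0.
Qed.

Let term (n : nat) (w : borel dual) : \bar R :=
  oapp (fun j => ((covolume (sys j))^-1 * density j w)%E) 0%E (@pickle_inv J n).

Let term_ge0 n w : (0 <= term n w)%E.
Proof. by rewrite /term; case: pickle_inv => //= j; rewrite mule_ge0 ?covolumeV_ge0. Qed.

Let measurable_term n : measurable_fun setT (term n).
Proof.
rewrite /term; case: pickle_inv => [j|] /=; last exact: measurable_cst.
exact: emeasurable_funM.
Qed.

Let calderon_sumE w : calderon_sum h w = (\sum_(n <oo) term n w)%E.
Proof.
rewrite /calderon_sum esum_countType//.
by move=> j; rewrite mule_ge0 ?covolumeV_ge0//; exact: density_ge0.
Qed.

Lemma calderon_sum_ge0 w : (0 <= calderon_sum h w)%E.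
Proof. by rewrite calderon_sumE nneseries_ge0. Qed.

Lemma measurable_calderon_sum : measurable_fun setT (calderon_sum h).
Proof.
rewrite (_ : calderon_sum h = (fun w => \sum_(n <oo) term n w)%E); last first.
  by apply/funext => w; exact: calderon_sumE.
by apply: ge0_emeasurable_sum => // k w _ _; exact: term_ge0.
Qed.

(** Monotone convergence takes the integral inside the sum, and Tonelli's theorem on [B] exchanges
    it with the integral over the index space. *)
Lemma integral_calderon_sum (B : set (borel dual)) : measurable B -> (muD B < +oo)%E ->
  (\int[muD]_(w in B) calderon_sum h w =
   \esum_(j in [set: J]) ((covolume (sys j))^-1 *
     \int[gti_index_measure (sys j)]_p \int[muD]_(w in B) (normc (h p w) ^+ 2)%:E))%E.
Proof.
move=> mB Bfin; under eq_integral do rewrite calderon_sumE.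
rewrite integral_nneseries//; last first.
  by move=> n; apply: measurable_funTS; exact: measurable_term.
rewrite esum_countType; last first.
  move=> j; rewrite mule_ge0 ?covolumeV_ge0//; apply: integral_ge0 => p _.
  by apply: integral_ge0 => w _; rewrite lee_fin sqr_ge0.
apply: eq_eseriesr => n _; rewrite /term; case: pickle_inv => [j|] /=; last by rewrite integral0.
rewrite ge0_integralZl//; last 2 first.
- by apply: measurable_funTS; exact: measurable_density.
- exact: covolumeV_ge0.
congr (_ * _)%E; apply/esym.
apply: (restricted_tonelli (gti_index_measure (sys j)) mB Bfin
  (f := fun z : gti_index (sys j) * borel dual => (normc (h z.1 z.2) ^+ 2)%:E)).
  by apply: measurable_nsq; have [] := hP j.
by move=> z; rewrite lee_fin sqr_ge0.
Qed.

(** On [B], an open set inside the essential support of [hat u], the modulus of [hat u] is at least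
    [c] almost everywhere. Hence [c ^+ 2] times each summand of the integrated Calderon sum is at
    most the matching summand of local integrability for [u]. *)
Lemma calderon_locally_integrable (E : set dual) (w0 : dual) : closed E -> ~ E w0 ->
  local_integrability muD sys E ->
  exists B : set (borel dual), [/\ measurable B, nbhs w0 B &
    (\int[muD]_(w in B) calderon_sum h w < +oo)%E].
Proof.
move=> cE nE lic; have [haarD _] := muD_plancherel.
have w0E : nbhs w0 (~` E).
  by apply: open_nbhs_nbhs; split => //; exact: closed_openC.
have [u [F [V [W [c [M [[u2 uF FM] [[cV VE F0] [w0W c0 cF]]]]]]]]] :=
  local_transform G_hausdorff G_second_countable muG_haar muG_sigma_finite muD_plancherel w0E.
have [hu2 huF] := plancherelP G_second_countable muG_sigma_finite muD_plancherel u2 uF.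
have clV : closed V by apply: compact_closed => //; exact: dual_hausdorff.
have supV := ess_support_sub clV huF F0.
pose S := ess_support muD (hat u).
have clS : closed S by exact: ess_support_closed.
have mS : measurable (S : set (borel dual)) by exact: borel_closed.
pose B : set (borel dual) := W^°.
have oB : open (W^° : set dual) by exact: open_interior.
have mB : measurable B by exact: borel_open.
have BW : B `<=` W by exact: interior_subset.
have BS : B `<=` S.
  apply: ess_support_open huF _ => // w /BW/cF cFw.
  by apply/eqP => Fw0; move: cFw; rewrite Fw0 Normc.normc0 leNgt c0.
have Bfin : (muD B < +oo)%E.
  apply: le_lt_trans (dual_compact_lty haarD cV); apply: le_measure; rewrite ?inE//.
    exact: borel_closed.
  exact: subset_trans supV.
exists B; split => //; first exact: nbhs_interior.
have test : test_space muG muD E u.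
  split => //.
  - split; first exact: hu2.1.
    rewrite /cnorm unlock; case: ifPn => // _.
    apply: (@le_lt_trans _ _ M%:E); last exact: ltry.
    apply/ess_supP; apply: negligibleS huF => w /= nle huFw; apply: nle.
    by rewrite huFw ger0_norm ?normc_ge0// lee_fin.
  - exact: (subclosed_compact clS cV).
  - exact: subset_trans VE.
have := lic _ test; rewrite integral_calderon_sum// => Lfin.
have c20 : 0 < c ^+ 2 by rewrite exprn_gt0.
pose a j : \bar R := ((covolume (sys j))^-1 *
  \int[gti_index_measure (sys j)]_p \int[muD]_(w in B) (normc (h p w) ^+ 2)%:E)%E.
have a0 j : (0 <= a j)%E.
  rewrite mule_ge0 ?covolumeV_ge0//; apply: integral_ge0 => p _.
  by apply: integral_ge0 => w _; rewrite lee_fin sqr_ge0.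
have mint j : measurable_fun setT (fun p => \int[muD]_(w in B) (normc (@h j p w) ^+ 2)%:E)%E.
  apply: (measurable_restricted_integral mB Bfin
    (f := fun z : gti_index (sys j) * borel dual => (normc (h z.1 z.2) ^+ 2)%:E)).
    by apply: measurable_nsq; have [] := hP j.
  by move=> z; rewrite lee_fin sqr_ge0.
have key : (\esum_(j in [set: J]) ((c ^+ 2)%:E * a j) < +oo)%E.
  apply: le_lt_trans Lfin; apply: le_esum => j _.
  rewrite /a muleCA; apply: lee_wpmul2l; first exact: covolumeV_ge0.
  rewrite -ge0_integralZl//; last 2 first.
  - by move=> p _; apply: integral_ge0 => w _; rewrite lee_fin sqr_ge0.
  - by rewrite lee_fin ltW.
  (* No measurability in [p] has been established for the sum over the annihilator, hence this form
     of monotonicity. *)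
  apply: ge0_le_integral_nonmeas => p.
    rewrite mule_ge0 ?lee_fin ?(ltW c20)//.
    by apply: integral_ge0 => w _; rewrite lee_fin sqr_ge0.
  have [hp _] := hP j; have g2 := gti_gen_L2 p.
  have [hg2 hgh] := plancherelP G_second_countable muG_sigma_finite muD_plancherel g2 (hp p).
  have mprod : cmeasurable (fun w : borel dual => hat u w * hat (gti_gen p) w).
    by apply: cmeasurableM; [exact: hu2.1|exact: hg2.1].
  have mhp : cmeasurable (@h j p) by have [[]] := hp p.
  apply: (@le_trans _ _ (\int[muD]_(w in S) (normc (hat u w * hat (gti_gen p) w) ^+ 2)%:E)%E).
    apply: (@le_trans _ _ (\int[muD]_(w in B) (normc (hat u w * hat (gti_gen p) w) ^+ 2)%:E)%E).
      rewrite -ge0_integralZl//; last 3 first.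
      - by apply: measurable_funTS; exact: measurable_nsq.
      - by move=> w _; rewrite lee_fin sqr_ge0.
      - by rewrite lee_fin ltW.
      (* [hat u] agrees with [F], and [hat (gti_gen p)] with [h p], only almost everywhere, so the
         pointwise bound holds off a null set. *)
      apply: ae_ge0_le_integral => //.
      + by move=> w _; rewrite -EFinM lee_fin mulr_ge0 ?sqr_ge0.
      + by apply: measurable_funTS; apply: emeasurable_funM => //; exact: measurable_nsq.
      + by move=> w _; rewrite lee_fin sqr_ge0.
      + by apply: measurable_funTS; exact: measurable_nsq.
      apply: negligibleS (negligibleU huF hgh) => w nle.
      apply: contrapT => /not_orP[/contrapT huFw /contrapT hghw]; apply: nle => Bw.
      rewrite -EFinM lee_fin hghw huFw Normc.normcM exprMn ler_wpM2r ?sqr_ge0//.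
      by rewrite ler_pXn2r ?nnegrE ?normc_ge0 ?(ltW c0)//; apply: cF; exact: BW.
    apply: ge0_subset_integral => //.
      by apply: measurable_funTS; exact: measurable_nsq.
    by move=> w _; rewrite lee_fin sqr_ge0.
  (* The sum dominates its term at the trivial character, where the argument of [hat u] is just
     [w]. *)
  apply: esum_ge; exists [set dual_one]; first by split => // _ ->.
  rewrite fsbig_set1.
  by under [leRHS]eq_integral do rewrite dual_mul1.
have -> : \esum_(j in [set: J]) a j = ((c ^+ 2)^-1%:E * \esum_(j in [set: J]) ((c ^+ 2)%:E * a j))%E.
  rewrite !esum_countType//; last by move=> j; rewrite mule_ge0 ?lee_fin ?(ltW c20).
  rewrite -nneseriesZl; last first.
    by move=> n _; case: pickle_inv => //= j; rewrite mule_ge0 ?lee_fin ?(ltW c20).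
  apply: eq_eseriesr => n _; case: pickle_inv => [j|] /=; last by rewrite mule0.
  by rewrite muleA -EFinM mulVf ?mul1e// gt_eqF.
by rewrite lte_mul_pinfty// lee_fin invr_ge0 ltW.
Qed.

(** Being contained in a measurable set over which the sum has finite integral passes to subsets and
    finite unions, so compactness glues the local bounds. *)
Lemma calderon_integrable_compact (E K : set dual) : closed E -> compact K -> K `<=` ~` E ->
  local_integrability muD sys E ->
  muD.-integrable (K : set (borel dual)) (calderon_sum h).
Proof.
move=> cE cK KE lic.
have mK : measurable (K : set (borel dual)) by apply: borel_compact => //; exact: dual_hausdorff.
have msum (B : set (borel dual)) : measurable_fun B (calderon_sum h).
  by apply: measurable_funTS; exact: measurable_calderon_sum.
pose P (A : set dual) := exists B : set (borel dual), [/\ measurable B, A `<=` B &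
    (\int[muD]_(w in B) calderon_sum h w < +oo)%E].
have [B [mB KB Bint]] : P K.
  apply: compact_union_ind => //.
  - by exists set0; split => //; rewrite integral_set0.
  - move=> A A' [B [mB AB iB]] [B' [mB' AB' iB']].
    exists (B `|` B'); split; [exact: measurableU|exact: setUSS|].
    (* The union is split into [B] and the part of the second set outside [B] to make the integral
       additive. *)
    rewrite -(setDUK (@subsetUl _ B B')) setDUl setDv set0U.
    rewrite ge0_integral_setU//; last 3 first.
    + exact: measurableD.
    + by move=> w _; exact: calderon_sum_ge0.
    + by rewrite disj_set2E setDIK.
    apply: lte_add_pinfty => //; apply: le_lt_trans iB'.
    apply: ge0_subset_integral => //; first exact: measurableD.
    by move=> w _; exact: calderon_sum_ge0.
  - by move=> A A' AA' [B [mB AB iB]]; exists B; split => //; exact: subset_trans AB.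
  - move=> w /KE nEw; have [B [mB wB iB]] := calderon_locally_integrable cE nEw lic.
    by exists B => //; exists B; split.
apply/integrableP; split => //.
rewrite (eq_integral (calderon_sum h)); last by move=> w _; rewrite gee0_abs// calderon_sum_ge0.
apply: le_lt_trans Bint; apply: ge0_subset_integral => // w _.
exact: calderon_sum_ge0.
Qed.

End calderon.

Theorem lemma3p2 (R : realType) (G : topologicalZmodType)
    (G_hausdorff : hausdorff_space G)
    (G_locally_compact : locally_compact [set: G])
    (G_second_countable : @second_countable G)
    (muG : {measure set (borelG G) -> \bar R})
    (muG_haar : @haar_measure R (pointed_group G) +%R muG)
    (muD : {measure set (borel (dual R G)) -> \bar R})
    (muD_plancherel : plancherel_measure muG muD)
    (J : countType) (sys : J -> gti_layer muG)
    (E : set (dual R G)) (E_null : null_closed muD E) :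
  local_integrability muD sys E -> calderon_integrability muD sys E.
Proof.
move=> lic; have [cE _] := E_null.
have sf := haar_sigma_finite muG_haar G_locally_compact G_second_countable.
split; last first.
  move=> h hP K cK KE.
  exact: (calderon_integrable_compact G_hausdorff G_second_countable muG_haar sf
    muD_plancherel hP cE cK KE lic).
(* The other half of the condition: a jointly measurable choice is made for each [j] separately. *)
have ex j := joint_transform_exists G_second_countable sf muD_plancherel
  (@gti_gen_L2 _ _ _ (sys j)) (@gti_gen_joint_measurable _ _ _ (sys j)).
exists (fun j => sval (cid (ex j))) => j.
exact: (svalP (cid (ex j))).
Qed.
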